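(* Let $\alpha\in(0,1)$, $\kappa>0$, $\epsilon>0$, and let $0=t_0<t_1<t_2<\cdots$ be time levels with steps $\tau_k=t_k-t_{k-1}$ and step ratios $r_1:=0$, $r_k:=\tau_k/\tau_{k-1}$ ($k\ge2$). Let $\phi^0,\phi^1,\dots,\phi^N$ satisfy the variable-step FBDF2 scheme $$(\mathcal{D}_\tau^\alpha \phi)^n=\kappa\Delta\mu^n,\qquad \mu^n=(\phi^n)^3-\phi^n-\epsilon^2\Delta\phi^n,\qquad 1\le n\le N.$$ Assume the step-ratio constraint $R_*\le r_k<r^*(\alpha)$ for all $k\ge2$, and the step-size condition $$\tau_n\le\Big(\frac{4\epsilon^2}{\kappa}\,\frac{\mathrm{g}(r_n,r_{n+1},\alpha)}{\Gamma(3-\alpha)}\Big)^{1/\alpha}\qquad\text{for } n\ge2.$$ Then the discrete energy satisfies $\mathcal{E}_\alpha[\phi^n]-\mathcal{E}_\alpha[\phi^{n-1}]\le0$ (equivalently $(\mathcal{E}_\alpha[\phi^n]-\mathcal{E}_\alpha[\phi^{n-1}])/\tau_n\le 0$) for $2\le n\le N$.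
   Context: $\Omega\subset\mathbb{R}^2$ is a bounded domain with periodic boundary conditions; $\langle\cdot,\cdot\rangle$, $\|\cdot\|$ denote the $L^2(\Omega)$ inner product and norm. For zero-mean $v,w$, $\langle v,w\rangle_{-1}:=\langle(-\Delta)^{-1}v,w\rangle$ and $\|v\|_{-1}:=\sqrt{\langle v,v\rangle_{-1}}$. Write $\nabla_\tau v^k:=v^k-v^{k-1}$. Notation: $\omega_\beta(t):=t^{\beta-1}/\Gamma(\beta)$. For $1\le k\le n$: $a^{(n)}_{n-k}:=\frac1{\tau_k}\int_{t_{k-1}}^{t_k}\omega_{1-\alpha}(t_n-s)\,ds$ and $\eta^{(n)}_{n-k}:=\frac{2}{\tau_k}\int_{t_{k-1}}^{t_k}\frac{s-t_{k-1/2}}{\tau_k}\omega_{1-\alpha}(t_n-s)\,ds$, with $t_{k-1/2}=(t_k+t_{k-1})/2$. FBDF2 formula: $(\mathcal{D}_\tau^\alpha v)^1:=a^{(1)}_0\nabla_\tau v^1$ and, for $n\ge2$, $$(\mathcal{D}_\tau^\alpha v)^n:=\sum_{k=1}^n a^{(n)}_{n-k}\nabla_\tau v^k+\frac{r_n\eta^{(n)}_0}{1+r_n}\big(\nabla_\tau v^n-r_n\nabla_\tau v^{n-1}\big)+\sum_{k=1}^{n-1}\frac{\eta^{(n)}_{n-k}\big(\nabla_\tau v^{k+1}-r_{k+1}\nabla_\tau v^k\big)}{r_{k+1}(1+r_{k+1})}.$$ Kernels: $\hat a^{(1)}_0:=a^{(1)}_0$; for $n\ge2$: $\hat a^{(n)}_0:=\frac{1-\alpha}{2-\alpha}a^{(n)}_0+\frac{\eta^{(n)}_1}{r_n(1+r_n)}$,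 $\hat a^{(n)}_{n-k}:=a^{(n)}_{n-k}-\frac{\eta^{(n)}_{n-k}}{1+r_{k+1}}+\frac{\eta^{(n)}_{n-k+1}}{r_k(1+r_k)}$ for $2\le k\le n-1$, $\hat a^{(n)}_{n-1}:=a^{(n)}_{n-1}-\frac{\eta^{(n)}_{n-1}}{1+r_2}$. Set $A^{(n)}_0:=2\hat a^{(n)}_0$ and $A^{(n)}_{n-k}:=\hat a^{(n)}_{n-k}$ for $1\le k\le n-1$. Constants/functions: $\mathrm{g}(x,y,\alpha):=\frac{2+2(1+\alpha)x-\alpha x^{2-\alpha/2}}{1+x}-\frac{\alpha y^{2-\alpha/2}}{1+y}$; $r^*(\alpha)$ is the unique positive root $z$ of $1/\alpha+(1+1/\alpha)z-z^{2-\alpha/2}=0$; $R_*=\frac19\sqrt[3]{\frac12(189-81\sqrt5)}+\frac13\sqrt[3]{\frac12(7+3\sqrt5)}-\frac13\approx0.4753$ (the unique positive root of $3-\frac{1}{z^2(1+z)}=0$). Energy: $E[\phi]:=\frac{\epsilon^2}{2}\|\nabla\phi\|^2+\langle F(\phi),1\rangle$ with $F(\phi)=\frac14(\phi^2-1)^2$, and for $n\ge1$ $$\mathcal{E}_\alpha[\phi^n]:=E[\phi^n]+\frac1\kappa\Big[\frac{\alpha r_{n+1}^{2-\alpha/2}}{2(1+r_{n+1})\tau_n^\alpha\Gamma(3-\alpha)}\|\nabla_\tau\phi^n\|_{-1}^2+\frac12\sum_{j=1}^{n-1}\big(A^{(n)}_{n-j-1}-A^{(n)}_{n-j}\big)\Big\|\sum_{\ell=j+1}^n\nabla_\tau\phi^\ell\Big\|_{-1}^2+\frac12A^{(n)}_{n-1}\Big\|\sum_{\ell=1}^n\nabla_\tau\phi^\ell\Big\|_{-1}^2\Big].$$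 *)

(* Defs.v *)
From Stdlib Require Import Reals Lra ClassicalEpsilon.
From Coquelicot Require Import Coquelicot.
Open Scope R_scope.

Definition Gamma (x : R) : R :=
  RInt_gen (fun s => Rpower s (x - 1) * exp (- s)) (at_right 0) (Rbar_locally p_infty).

Definition omega (beta t : R) : R := Rpower t (beta - 1) / Gamma beta.

Definition dx (f : R -> R -> R) : R -> R -> R := fun x y => Derive (fun s => f s y) x.
Definition dy (f : R -> R -> R) : R -> R -> R := fun x y => Derive (fun s => f x s) y.
Definition pd (i j : nat) (f : R -> R -> R) : R -> R -> R := Nat.iter i dx (Nat.iter j dy f).

Definition Ck (k : nat) (f : R -> R -> R) : Prop :=
  forall i j : nat, (i + j <= k)%nat ->
    (forall x y, continuous (fun p : R * R => pd i j f (fst p) (snd p)) (x, y)) /\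
    ((i + j < k)%nat -> forall x y,
        ex_derive (fun s => pd i j f s y) x /\ ex_derive (fun s => pd i j f x s) y).

Definition periodic (L1 L2 : R) (f : R -> R -> R) : Prop :=
  forall x y, f (x + L1) y = f x y /\ f x (y + L2) = f x y.

Definition lap (f : R -> R -> R) : R -> R -> R := fun x y => dx (dx f) x y + dy (dy f) x y.

Definition ip (L1 L2 : R) (u v : R -> R -> R) : R :=
  RInt (fun x => RInt (fun y => u x y * v x y) 0 L2) 0 L1.
Definition L2norm (L1 L2 : R) (u : R -> R -> R) : R := sqrt (ip L1 L2 u u).
Definition gradnorm (L1 L2 : R) (u : R -> R -> R) : R :=
  sqrt (ip L1 L2 (dx u) (dx u) + ip L1 L2 (dy u) (dy u)).

Definition inv_neg_lap (L1 L2 : R) (v : R -> R -> R) : R -> R -> R :=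
  epsilon (inhabits (fun _ _ => 0))
    (fun w => periodic L1 L2 w /\ Ck 2 w /\ ip L1 L2 w (fun _ _ => 1) = 0 /\
              forall x y, - lap w x y = v x y).
Definition ip_m1 (L1 L2 : R) (v w : R -> R -> R) : R := ip L1 L2 (inv_neg_lap L1 L2 v) w.
Definition norm_m1 (L1 L2 : R) (v : R -> R -> R) : R := sqrt (ip_m1 L1 L2 v v).

Definition tau (t : nat -> R) (k : nat) : R := t k - t (k - 1)%nat.
(* r_1 := 0, r_k := tau_k / tau_{k-1} for k >= 2 (r_0 unused, set to 0) *)
Definition ratio (t : nat -> R) (k : nat) : R :=
  match k with 0%nat | 1%nat => 0 | _ => tau t k / tau t (k - 1)%nat end.

(* a^{(n)}_{n-k}  (improper integral; the integrand is singular at s = t_n when k = n) *)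
Definition akern (al : R) (t : nat -> R) (n k : nat) : R :=
  / tau t k * RInt_gen (fun s => omega (1 - al) (t n - s))
                       (at_point (t (k - 1)%nat)) (at_left (t k)).
Definition etakern (al : R) (t : nat -> R) (n k : nat) : R :=
  2 / tau t k * RInt_gen (fun s => (s - (t k + t (k - 1)%nat) / 2) / tau t k
                                     * omega (1 - al) (t n - s))
                         (at_point (t (k - 1)%nat)) (at_left (t k)).

Definition dtau (v : nat -> R -> R -> R) (k : nat) : R -> R -> R :=
  fun x y => v k x y - v (k - 1)%nat x y.

Definition FBDF2 (al : R) (t : nat -> R) (v : nat -> R -> R -> R) (n : nat) : R -> R -> R :=
  fun x y =>
  match n with
  | 0%nat => 0
  | 1%nat => akern al t 1 1 * dtau v 1 x y
  | _ =>
      sum_n_m (fun k => akern al t n k * dtau v k x y) 1 n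
      + ratio t n * etakern al t n n / (1 + ratio t n)
          * (dtau v n x y - ratio t n * dtau v (n - 1)%nat x y)
      + sum_n_m (fun k => etakern al t n k
                   * (dtau v (k + 1)%nat x y - ratio t (k + 1)%nat * dtau v k x y)
                   / (ratio t (k + 1)%nat * (1 + ratio t (k + 1)%nat))) 1 (n - 1)
  end.

Definition hatakern (al : R) (t : nat -> R) (n k : nat) : R :=
  if (n =? 1)%nat then akern al t 1 1
  else if (k =? n)%nat then
    (1 - al) / (2 - al) * akern al t n n
      + etakern al t n (n - 1)%nat / (ratio t n * (1 + ratio t n))
  else if (k =? 1)%nat then
    akern al t n 1 - etakern al t n 1 / (1 + ratio t 2)
  else
    akern al t n k - etakern al t n k / (1 + ratio t (k + 1)%nat)
      + etakern al t n (k - 1)%nat / (ratio t k * (1 + ratio t k)).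

Definition Akern (al : R) (t : nat -> R) (n k : nat) : R :=
  if (k =? n)%nat then 2 * hatakern al t n n else hatakern al t n k.

Definition Fdw (p : R) : R := / 4 * (p ^ 2 - 1) ^ 2.

Definition Energy (L1 L2 eps : R) (phi : R -> R -> R) : R :=
  eps ^ 2 / 2 * gradnorm L1 L2 phi ^ 2 + ip L1 L2 (fun x y => Fdw (phi x y)) (fun _ _ => 1).

Definition dsum (phi : nat -> R -> R -> R) (j n : nat) : R -> R -> R :=
  fun x y => sum_n_m (fun l => dtau phi l x y) (j + 1)%nat n.

Definition EnergyAlpha (L1 L2 eps kappa al : R) (t : nat -> R)
    (phi : nat -> R -> R -> R) (n : nat) : R :=
  Energy L1 L2 eps (phi n)
  + / kappa *
    ( al * Rpower (ratio t (n + 1)%nat) (2 - al / 2)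
        / (2 * (1 + ratio t (n + 1)%nat) * Rpower (tau t n) al * Gamma (3 - al))
        * norm_m1 L1 L2 (dtau phi n) ^ 2
    + / 2 * sum_n_m (fun j => (Akern al t n (j + 1)%nat - Akern al t n j)
                               * norm_m1 L1 L2 (dsum phi j n) ^ 2) 1 (n - 1)
    + / 2 * Akern al t n 1 * norm_m1 L1 L2 (dsum phi 0 n) ^ 2 ).

Definition gfun (x y al : R) : R :=
  (2 + 2 * (1 + al) * x - al * Rpower x (2 - al / 2)) / (1 + x)
  - al * Rpower y (2 - al / 2) / (1 + y).

(* r^*(alpha): the unique positive root of 1/al + (1 + 1/al) z - z^(2 - al/2) = 0 *)
Definition rstar (al : R) : R :=
  epsilon (inhabits 0)
    (fun z => 0 < z /\ / al + (1 + / al) * z - Rpower z (2 - al / 2) = 0).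

Definition Rstar : R :=
  / 9 * Rpower ((189 - 81 * sqrt 5) / 2) (/ 3)
  + / 3 * Rpower ((7 + 3 * sqrt 5) / 2) (/ 3) - / 3.

(* Main.v *)
(* Every increment w_k = phi^k - phi^(k-1) is -Laplace(W_k) for a periodic C^2 function
   W_k, so testing the scheme with W_n turns the time-fractional term into the integral
   of the pointwise quadratic form V_n . (sum_k c_k V_k) with V_k = grad W_k.
   Writing hat a_0 = A_0 / 2 and summing by parts, the kernel part of this form dominates
   the increment of the quadratic part of the modified energy as soon as
   A^(n)_(n-1) <= A^(n-1)_(n-2) and the first differences of A^(n) are bounded by those of
   A^(n-1). These differences are functionals of omega(t_(n-1) - s) - omega(t_n - s),
   which is increasing and convex in s, and 3 r^2 (1 + r) >= 1 is what makes them
   nonnegative. Young's inequality on the two remaining terms of the scheme leaves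
   g / (2 tau_n^alpha Gamma(3 - alpha)) |V_n|^2. The nonlinear part gives the energy up to
   |w_n|^2 / 2, and the integral of |w_n|^2 equals that of grad w_n . V_n, which the
   step-size condition absorbs into eps^2 |grad w_n|^2 / 2 and the |V_n|^2 term. *)
Require Import Defs.
From Stdlib Require Import Reals.
From Coquelicot Require Import Coquelicot.
From Stdlib Require Import Lra Lia FunctionalExtensionality ClassicalEpsilon.
Open Scope R_scope.

(** Write [D k] for [Akern (n-1) k - Akern n k]. The increment condition is [D j <= D (j+1)]. The
    first moment over step j enters both sides, with weights [1/(1+r)] and [1/(r(1+r))], r being the
    ratio of index j+1; they add up to [1/r]. Once this moment is collected on the left, the two
    sides are separated by the value at [s = t_j] of [omega(t_(n-1) - s) - omega(t_n - s)]. The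
    obstacle is the last pair, j + 1 = n - 1: the integrand of level n-1 is singular at the end of
    that step, so the convexity bounds do not apply. There the diagonal entry is explicit. The
    doubling in A_0 turns its part [(1-al)/(2-al) a_0] into
    [(1 + al/(2-al)) omega(t_(n-1) - t_(n-2))], and the neighbouring entry of level n is bounded by
    the same factor times [omega(t_n - t_(n-2))]. A second obstacle is the negative norm:
    [inv_neg_lap] is a choice operator, informative only once a solution of Poisson's equation is
    exhibited. All inequalities for the memory terms are proved for scalar sequences and applied at
    each point to each component of grad W_k. *)

(** * Joint continuity and integrals depending on a parameter *)

Definition cont2 (f : R -> R -> R) : Prop :=
  forall x y, continuous (fun p : R * R => f (fst p) (snd p)) (x, y).

Lemma cont2_const (c : R) : cont2 (fun _ _ => c).
Proof. intros x y; apply continuous_const. Qed.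

Lemma cont2_plus (f g : R -> R -> R) :
  cont2 f -> cont2 g -> cont2 (fun x y => f x y + g x y).
Proof.
  intros Hf Hg x y.
  apply (continuous_plus (fun p : R * R => f (fst p) (snd p)) (fun p => g (fst p) (snd p)));
    [apply Hf | apply Hg].
Qed.

Lemma cont2_mult (f g : R -> R -> R) :
  cont2 f -> cont2 g -> cont2 (fun x y => f x y * g x y).
Proof.
  intros Hf Hg x y.
  apply (continuous_mult (fun p : R * R => f (fst p) (snd p)) (fun p => g (fst p) (snd p)));
    [apply Hf | apply Hg].
Qed.

Lemma cont2_opp (f : R -> R -> R) : cont2 f -> cont2 (fun x y => - f x y).
Proof.
  intros Hf x y.
  apply (continuous_opp (fun p : R * R => f (fst p) (snd p))); apply Hf.
Qed.

Lemma cont2_minus (f g : R -> R -> R) :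
  cont2 f -> cont2 g -> cont2 (fun x y => f x y - g x y).
Proof. intros Hf Hg; apply cont2_plus, cont2_opp; assumption. Qed.

Lemma cont2_pow (f : R -> R -> R) (n : nat) : cont2 f -> cont2 (fun x y => f x y ^ n).
Proof.
  intros Hf; induction n as [|n IH]; simpl.
  - apply cont2_const.
  - apply cont2_mult; assumption.
Qed.

Lemma cont2_sum (f : nat -> R -> R -> R) (n m : nat) :
  (forall k, (n <= k <= m)%nat -> cont2 (f k)) ->
  cont2 (fun x y => sum_n_m (fun k => f k x y) n m).
Proof.
  intros Hf.
  destruct (Nat.lt_ge_cases m n) as [Hlt|Hge].
  { intros x y; apply continuous_ext with (fun _ => 0).
    - intros p; rewrite sum_n_m_zero; [reflexivity | exact Hlt].
    - apply continuous_const. }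
  induction Hge as [|m Hge IH].
  - intros x y; apply continuous_ext with (fun p => f n (fst p) (snd p)).
    + intros p; rewrite sum_n_n; reflexivity.
    + apply Hf; lia.
  - intros x y.
    apply continuous_ext
      with (fun p => sum_n_m (fun k => f k (fst p) (snd p)) n m + f (S m) (fst p) (snd p)).
    + intros p; rewrite sum_n_Sm; [reflexivity | lia].
    + apply (cont2_plus (fun x y => sum_n_m (fun k => f k x y) n m) (f (S m))).
      * apply IH; intros k Hk; apply Hf; lia.
      * apply Hf; lia.
Qed.

Lemma cont2_y (f : R -> R -> R) (x y : R) : cont2 f -> continuous (fun s => f x s) y.
Proof.
  intros Hf.
  apply (continuous_comp_2 (fun _ => x) (fun s => s) f);
    [apply continuous_const | apply continuous_id | apply Hf].
Qed.

Lemma cont2_pt (f : R -> R -> R) (x y : R) : cont2 f -> continuity_2d_pt f x y.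
Proof. intros Hf; apply continuity_2d_pt_filterlim, Hf. Qed.

Lemma ex_RInt_y (f : R -> R -> R) (x a b : R) : cont2 f -> ex_RInt (f x) a b.
Proof.
  intros Hf; apply (ex_RInt_continuous (V := R_CompleteNormedModule)).
  intros; apply (cont2_y f); exact Hf.
Qed.

(** Uniform continuity of f on the compact rectangle [x-1, x+1] x [a, b] makes the integrands
    uniformly close. *)
Lemma continuous_RInt_param (f : R -> R -> R) (a b : R) (x : R) :
  a <= b -> cont2 f -> continuous (fun s => RInt (f s) a b) x.
Proof.
  intros Hab Hf.
  apply continuity_pt_filterlim.
  intros eps Heps.
  (* The [+ 1] keeps the denominator positive when a = b. *)
  assert (He : 0 < eps / (2 * (b - a + 1))) by (apply Rdiv_lt_0_compat; lra).
  destruct (uniform_continuity_2d f (x - 1) (x + 1) a b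
    (fun u v _ _ => cont2_pt f u v Hf) (mkposreal _ He)) as [d Hd].
  simpl in Hd.
  exists (Rmin d 1); split.
  { apply Rmin_glb_lt; [apply cond_pos | lra]. }
  intros s [_ Hs]; simpl in Hs; unfold Rdist in Hs; simpl; unfold Rdist.
  assert (H1 := Rmin_l d 1). assert (H2 := Rmin_r d 1).
  apply Rabs_def2 in Hs.
  assert (Hm : RInt (f s) a b - RInt (f x) a b = RInt (fun y => f s y - f x y) a b).
  { symmetry; apply (RInt_minus (V := R_CompleteNormedModule) (f s) (f x));
      apply ex_RInt_y; exact Hf. }
  rewrite Hm.
  apply Rle_lt_trans with ((b - a) * (eps / (2 * (b - a + 1)))).
  - apply abs_RInt_le_const; [exact Hab | |].
    + apply (ex_RInt_minus (V := R_NormedModule) (f s) (f x)); apply ex_RInt_y; exact Hf.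
    + intros y Hy; left; apply Hd; try lra.
      * apply Rabs_def1; lra.
      * rewrite Rminus_diag, Rabs_R0; apply cond_pos.
  - replace ((b - a) * (eps / (2 * (b - a + 1)))) with (eps * ((b - a) / (2 * (b - a + 1))))
      by (field; lra).
    rewrite <- (Rmult_1_r eps) at 2.
    apply Rmult_lt_compat_l; [exact Heps|].
    apply Rmult_lt_reg_r with (2 * (b - a + 1)); [lra|].
    replace ((b - a) / (2 * (b - a + 1)) * (2 * (b - a + 1))) with (b - a) by (field; lra).
    lra.
Qed.

(** * Smoothness in terms of iterated partial derivatives *)

(** [Ck] only speaks of mixed derivatives with all y-derivatives taken first. Here the order of
    differentiation is arbitrary, so the notion passes to [dx f] and [dy f] by definition and sums
    and products follow by induction on k. *)
Fixpoint smooth (k : nat) (f : R -> R -> R) : Prop :=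
  cont2 f /\
  match k with
  | O => True
  | S k' => (forall x y, ex_derive (fun s => f s y) x /\ ex_derive (fun s => f x s) y)
            /\ smooth k' (dx f) /\ smooth k' (dy f)
  end.

Lemma smooth_cont2 (k : nat) (f : R -> R -> R) : smooth k f -> cont2 f.
Proof. destruct k; intros [H _]; exact H. Qed.

Lemma smooth_dx (k : nat) (f : R -> R -> R) : smooth (S k) f -> smooth k (dx f).
Proof. intros [_ [_ [H _]]]; exact H. Qed.

Lemma smooth_dy (k : nat) (f : R -> R -> R) : smooth (S k) f -> smooth k (dy f).
Proof. intros [_ [_ [_ H]]]; exact H. Qed.

Lemma smooth_ex_dx (k : nat) (f : R -> R -> R) (x y : R) :
  smooth (S k) f -> ex_derive (fun s => f s y) x.
Proof. intros [_ [H _]]; exact (proj1 (H x y)). Qed.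

Lemma smooth_ex_dy (k : nat) (f : R -> R -> R) (x y : R) :
  smooth (S k) f -> ex_derive (fun s => f x s) y.
Proof. intros [_ [H _]]; exact (proj2 (H x y)). Qed.

Lemma smooth_pred (k : nat) (f : R -> R -> R) : smooth (S k) f -> smooth k f.
Proof.
  revert f; induction k as [|k IH]; intros f H.
  - destruct H as [Hc _]; split; [exact Hc | exact I].
  - destruct H as [Hc [Hd [Hx Hy]]].
    split; [exact Hc|split; [exact Hd|split; apply IH; assumption]].
Qed.

Lemma smooth_le (j k : nat) (f : R -> R -> R) : (j <= k)%nat -> smooth k f -> smooth j f.
Proof. induction 1; [trivial | intros H'; apply IHle, smooth_pred, H']. Qed.

Lemma dx_const (c : R) : dx (fun _ _ => c) = fun _ _ => 0.
Proof. extensionality x; extensionality y; exact (Derive_const c x). Qed.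

Lemma dy_const (c : R) : dy (fun _ _ => c) = fun _ _ => 0.
Proof. extensionality x; extensionality y; exact (Derive_const c y). Qed.

Lemma smooth_const (k : nat) (c : R) : smooth k (fun _ _ => c).
Proof.
  revert c; induction k as [|k IH]; intros c.
  - split; [apply cont2_const | exact I].
  - split; [apply cont2_const|split].
    + intros x y; split; apply ex_derive_const.
    + rewrite dx_const, dy_const; split; apply IH.
Qed.

Lemma dx_plus (k : nat) (f g : R -> R -> R) : smooth (S k) f -> smooth (S k) g ->
  dx (fun x y => f x y + g x y) = fun x y => dx f x y + dx g x y.
Proof.
  intros Hf Hg; extensionality x; extensionality y.
  apply Derive_plus; eapply smooth_ex_dx; eassumption.
Qed.

Lemma dy_plus (k : nat) (f g : R -> R -> R) : smooth (S k) f -> smooth (S k) g ->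
  dy (fun x y => f x y + g x y) = fun x y => dy f x y + dy g x y.
Proof.
  intros Hf Hg; extensionality x; extensionality y.
  apply Derive_plus; eapply smooth_ex_dy; eassumption.
Qed.

Lemma smooth_plus (k : nat) (f g : R -> R -> R) :
  smooth k f -> smooth k g -> smooth k (fun x y => f x y + g x y).
Proof.
  revert f g; induction k as [|k IH]; intros f g Hf Hg.
  - split; [apply cont2_plus; eapply smooth_cont2; eassumption | exact I].
  - split; [apply cont2_plus; eapply smooth_cont2; eassumption|split].
    + intros x y; split.
      * apply (ex_derive_plus (fun s => f s y) (fun s => g s y)); eapply smooth_ex_dx; eassumption.
      * apply (ex_derive_plus (fun s => f x s) (fun s => g x s)); eapply smooth_ex_dy; eassumption.
    + rewrite (dx_plus k), (dy_plus k) by assumption.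
      split; apply IH; (apply smooth_dx || apply smooth_dy); assumption.
Qed.

Lemma dx_mult (k : nat) (f g : R -> R -> R) : smooth (S k) f -> smooth (S k) g ->
  dx (fun x y => f x y * g x y) = fun x y => dx f x y * g x y + f x y * dx g x y.
Proof.
  intros Hf Hg; extensionality x; extensionality y.
  apply Derive_mult; eapply smooth_ex_dx; eassumption.
Qed.

Lemma dy_mult (k : nat) (f g : R -> R -> R) : smooth (S k) f -> smooth (S k) g ->
  dy (fun x y => f x y * g x y) = fun x y => dy f x y * g x y + f x y * dy g x y.
Proof.
  intros Hf Hg; extensionality x; extensionality y.
  apply Derive_mult; eapply smooth_ex_dy; eassumption.
Qed.

Lemma smooth_mult (k : nat) (f g : R -> R -> R) :
  smooth k f -> smooth k g -> smooth k (fun x y => f x y * g x y).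
Proof.
  revert f g; induction k as [|k IH]; intros f g Hf Hg.
  - split; [apply cont2_mult; eapply smooth_cont2; eassumption | exact I].
  - split; [apply cont2_mult; eapply smooth_cont2; eassumption|split].
    + intros x y; split.
      * apply (ex_derive_mult (fun s => f s y) (fun s => g s y)); eapply smooth_ex_dx; eassumption.
      * apply (ex_derive_mult (fun s => f x s) (fun s => g x s)); eapply smooth_ex_dy; eassumption.
    + rewrite (dx_mult k), (dy_mult k) by assumption.
      split; apply smooth_plus; apply IH;
        solve [apply smooth_dx; assumption | apply smooth_dy; assumption
              | apply smooth_pred; assumption].
Qed.

Lemma smooth_scal (k : nat) (c : R) (f : R -> R -> R) :
  smooth k f -> smooth k (fun x y => c * f x y).
Proof. intros Hf; apply (smooth_mult k (fun _ _ => c)); [apply smooth_const | exact Hf]. Qed.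

Lemma dx_scal (c : R) (f : R -> R -> R) : dx (fun x y => c * f x y) = fun x y => c * dx f x y.
Proof. extensionality x; extensionality y; apply Derive_scal. Qed.

Lemma dy_scal (c : R) (f : R -> R -> R) : dy (fun x y => c * f x y) = fun x y => c * dy f x y.
Proof. extensionality x; extensionality y; apply Derive_scal. Qed.

(** Unlike Schwarz' theorem, no continuity of [dy (dx f)] is assumed: differentiate
    [f x y - f x 0 = RInt (dy f x) 0 y] under the integral. *)
Lemma dy_dx_comm (f : R -> R -> R) :
  (forall x y, ex_derive (fun s => f x s) y) ->
  (forall x y, ex_derive (fun s => f s y) x) ->
  cont2 (dy f) -> (forall x y, ex_derive (fun s => dy f s y) x) -> cont2 (dx (dy f)) ->
  dy (dx f) = dx (dy f).
Proof.
  intros Hfy Hfx Hc Hd Hcc.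
  assert (HF : forall x y, f x y = f x 0 + RInt (dy f x) 0 y).
  { intros x y.
    assert (H : RInt (Derive (f x)) 0 y = f x y - f x 0).
    { apply RInt_Derive; intros; [apply Hfy | apply (cont2_y (dy f)); exact Hc]. }
    change (RInt (dy f x) 0 y) with (RInt (Derive (f x)) 0 y).
    rewrite H; ring. }
  assert (Hx : forall x y, dx f x y = dx f x 0 + RInt (dx (dy f) x) 0 y).
  { intros x y; unfold dx at 1.
    apply is_derive_unique.
    apply is_derive_ext with (fun s => f s 0 + RInt (dy f s) 0 y); [intros; symmetry; apply HF|].
    apply (is_derive_plus (fun s => f s 0) (fun s => RInt (dy f s) 0 y)).
    - apply Derive_correct, Hfx.
    - apply (is_derive_RInt_param (dy f)).
      + apply filter_forall; intros; apply Hd.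
      + intros; apply cont2_pt; exact Hcc.
      + apply filter_forall; intros; apply ex_RInt_y; exact Hc. }
  extensionality x; extensionality y; unfold dy at 1.
  apply is_derive_unique.
  apply is_derive_ext with (fun s => dx f x 0 + RInt (dx (dy f) x) 0 s); [intros; symmetry; apply Hx|].
  replace (dx (dy f) x y) with (0 + dx (dy f) x y) by ring.
  apply (is_derive_plus (fun s => dx f x 0)).
  - apply is_derive_Reals, derivable_pt_lim_const.
  - apply (is_derive_RInt (dx (dy f) x)  _ 0).
    + apply filter_forall; intros; apply (RInt_correct (V := R_CompleteNormedModule)), ex_RInt_y; exact Hcc.
    + apply (cont2_y (dx (dy f))); exact Hcc.
Qed.

Lemma Nat_iter_comm {A : Type} (f : A -> A) (n : nat) (a : A) :
  Nat.iter n f (f a) = f (Nat.iter n f a).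
Proof. induction n as [|n IH]; simpl; [reflexivity | rewrite IH; reflexivity]. Qed.

(** In [pd i j (dx f)] the x-derivative is innermost, whereas [Ck] controls it only outermost. It is
    moved outwards past one [dy] at a time; each exchange uses a derivative of total order at most k
    + 1. *)
Lemma Ck_dx (k : nat) (f : R -> R -> R) : Ck (S k) f -> Ck k (dx f).
Proof.
  intros H.
  assert (Hc : forall j, (j <= k)%nat -> Nat.iter j dy (dx f) = dx (Nat.iter j dy f)).
  { induction j as [|j IH]; intros Hj; [reflexivity|].
    simpl; rewrite IH by lia.
    apply dy_dx_comm.
    - intros x y; exact (proj2 (proj2 (H 0%nat j ltac:(lia)) ltac:(lia) x y)).
    - intros x y; exact (proj1 (proj2 (H 0%nat j ltac:(lia)) ltac:(lia) x y)).
    - intros x y; exact (proj1 (H 0%nat (S j) ltac:(lia)) x y).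
    - intros x y; exact (proj1 (proj2 (H 0%nat (S j) ltac:(lia)) ltac:(lia) x y)).
    - intros x y; exact (proj1 (H 1%nat (S j) ltac:(lia)) x y). }
  assert (Hp : forall i j, (i + j <= k)%nat -> pd i j (dx f) = pd (S i) j f).
  { intros i j Hij; unfold pd; rewrite Hc by lia; exact (Nat_iter_comm dx i _). }
  intros i j Hij; rewrite Hp by exact Hij.
  destruct (H (S i) j) as [H1 H2]; [lia|]; split; [exact H1|].
  intros; apply H2; lia.
Qed.

Lemma Ck_dy (k : nat) (f : R -> R -> R) : Ck (S k) f -> Ck k (dy f).
Proof.
  intros H i j Hij.
  assert (Hp : pd i j (dy f) = pd i (S j) f) by (unfold pd; rewrite Nat_iter_comm; reflexivity).
  rewrite Hp.
  destruct (H i (S j)) as [H1 H2]; [lia|]; split; [exact H1|].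
  intros; apply H2; lia.
Qed.

Lemma Ck_smooth (k : nat) (f : R -> R -> R) : Ck k f -> smooth k f.
Proof.
  revert f; induction k as [|k IH]; intros f H.
  - split; [exact (proj1 (H 0%nat 0%nat ltac:(lia))) | exact I].
  - split; [exact (proj1 (H 0%nat 0%nat ltac:(lia)))|split].
    + exact (proj2 (H 0%nat 0%nat ltac:(lia)) ltac:(lia)).
    + split; apply IH; [apply Ck_dx | apply Ck_dy]; exact H.
Qed.

Lemma smooth_iter_dy (k j : nat) (f : R -> R -> R) :
  smooth (k + j) f -> smooth k (Nat.iter j dy f).
Proof.
  revert f; induction j as [|j IH]; intros f H.
  - rewrite Nat.add_0_r in H; exact H.
  - rewrite Nat.add_succ_r in H; simpl.
    rewrite <- Nat_iter_comm; apply IH, smooth_dy, H.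
Qed.

Lemma smooth_iter_dx (k j : nat) (f : R -> R -> R) :
  smooth (k + j) f -> smooth k (Nat.iter j dx f).
Proof.
  revert f; induction j as [|j IH]; intros f H.
  - rewrite Nat.add_0_r in H; exact H.
  - rewrite Nat.add_succ_r in H; simpl.
    rewrite <- Nat_iter_comm; apply IH, smooth_dx, H.
Qed.

Lemma smooth_Ck (k : nat) (f : R -> R -> R) : smooth k f -> Ck k f.
Proof.
  intros H i j Hij.
  assert (Hs : smooth (k - i - j) (pd i j f)).
  { apply smooth_iter_dx, smooth_iter_dy.
    replace (k - i - j + i + j)%nat with k by lia; exact H. }
  split.
  - intros x y; apply (smooth_cont2 _ _ Hs).
  - intros Hlt x y.
    replace (k - i - j)%nat with (S (k - i - j - 1)) in Hs by lia.
    split; [eapply smooth_ex_dx | eapply smooth_ex_dy]; exact Hs.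
Qed.

(** * Integration over the periodic cell *)

(** [ip L1 L2 u v] is convertible to [iint] of the pointwise product, which the [change] steps below
    exploit. *)
Definition iint (L1 L2 : R) (f : R -> R -> R) : R :=
  RInt (fun x => RInt (f x) 0 L2) 0 L1.

Lemma ex_RInt_iint (L1 L2 : R) (f : R -> R -> R) :
  0 < L2 -> cont2 f -> ex_RInt (fun x => RInt (f x) 0 L2) 0 L1.
Proof.
  intros HL Hf; apply (ex_RInt_continuous (V := R_CompleteNormedModule)).
  intros; apply continuous_RInt_param; [lra | exact Hf].
Qed.

Lemma iint_ext (L1 L2 : R) (f g : R -> R -> R) :
  (forall x y, f x y = g x y) -> iint L1 L2 f = iint L1 L2 g.
Proof.
  intros H; apply RInt_ext; intros x _; apply RInt_ext; intros y _; apply H.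
Qed.

Lemma iint_plus (L1 L2 : R) (f g : R -> R -> R) : 0 < L2 -> cont2 f -> cont2 g ->
  iint L1 L2 (fun x y => f x y + g x y) = iint L1 L2 f + iint L1 L2 g.
Proof.
  intros HL Hf Hg; unfold iint.
  rewrite <- (RInt_plus (V := R_CompleteNormedModule) (fun x => RInt (f x) 0 L2)
               (fun x => RInt (g x) 0 L2)) by (apply ex_RInt_iint; assumption).
  apply RInt_ext; intros x _.
  apply (RInt_plus (V := R_CompleteNormedModule) (f x) (g x)); apply ex_RInt_y; assumption.
Qed.

Lemma iint_scal (L1 L2 : R) (c : R) (f : R -> R -> R) : 0 < L2 -> cont2 f ->
  iint L1 L2 (fun x y => c * f x y) = c * iint L1 L2 f.
Proof.
  intros HL Hf; unfold iint.
  rewrite <- (RInt_scal (V := R_CompleteNormedModule) (fun x => RInt (f x) 0 L2))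
    by (apply ex_RInt_iint; assumption).
  apply RInt_ext; intros x _.
  apply (RInt_scal (V := R_CompleteNormedModule) (f x)); apply ex_RInt_y; assumption.
Qed.

Lemma iint_minus (L1 L2 : R) (f g : R -> R -> R) : 0 < L2 -> cont2 f -> cont2 g ->
  iint L1 L2 (fun x y => f x y - g x y) = iint L1 L2 f - iint L1 L2 g.
Proof.
  intros HL Hf Hg.
  rewrite (iint_ext _ _ _ (fun x y => f x y + (-1) * g x y)) by (intros; ring).
  rewrite iint_plus, iint_scal;
    [ring | assumption.. | apply cont2_mult; [apply cont2_const | assumption]].
Qed.

Lemma iint_sum (L1 L2 : R) (f : nat -> R -> R -> R) (n m : nat) : 0 < L2 ->
  (forall k, (n <= k <= m)%nat -> cont2 (f k)) ->
  iint L1 L2 (fun x y => sum_n_m (fun k => f k x y) n m)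
  = sum_n_m (fun k => iint L1 L2 (f k)) n m.
Proof.
  intros HL Hf.
  destruct (Nat.lt_ge_cases m n) as [Hlt|Hge].
  { rewrite (iint_ext _ _ _ (fun x y => 0 * 0)).
    - rewrite (iint_scal _ _ 0 (fun _ _ => 0)), sum_n_m_zero;
        [apply Rmult_0_l | exact Hlt | exact HL | apply cont2_const].
    - intros x y; rewrite sum_n_m_zero by exact Hlt; symmetry; apply Rmult_0_l. }
  induction Hge as [|m Hge IH].
  - rewrite sum_n_n; apply iint_ext; intros; rewrite sum_n_n; reflexivity.
  - rewrite sum_n_Sm by lia.
    rewrite (iint_ext _ _ _ (fun x y => sum_n_m (fun k => f k x y) n m + f (S m) x y))
      by (intros; rewrite sum_n_Sm; [reflexivity | lia]).
    rewrite (iint_plus L1 L2 (fun x y => sum_n_m (fun k => f k x y) n m)).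
    + rewrite IH; [reflexivity | intros k Hk; apply Hf; lia].
    + exact HL.
    + apply cont2_sum; intros k Hk; apply Hf; lia.
    + apply Hf; lia.
Qed.

Lemma iint_ge_0 (L1 L2 : R) (f : R -> R -> R) : 0 < L1 -> 0 < L2 -> cont2 f ->
  (forall x y, 0 <= f x y) -> 0 <= iint L1 L2 f.
Proof.
  intros HL1 HL2 Hf H; apply RInt_ge_0; [lra | apply ex_RInt_iint; assumption|].
  intros x _; apply RInt_ge_0; [lra | apply ex_RInt_y; assumption | intros; apply H].
Qed.

Lemma iint_const (L1 L2 c : R) : iint L1 L2 (fun _ _ => c) = L1 * L2 * c.
Proof.
  unfold iint; rewrite (RInt_ext _ (fun _ => L2 * c)).
  - rewrite RInt_const; unfold scal; simpl; unfold mult; simpl; ring.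
  - intros x _; rewrite RInt_const; unfold scal; simpl; unfold mult; simpl; ring.
Qed.

(** * Periodic functions and Green's formula *)

Lemma periodic_dx (L1 L2 : R) (f : R -> R -> R) : periodic L1 L2 f -> periodic L1 L2 (dx f).
Proof.
  intros H x y; unfold dx; split.
  - rewrite (Derive_ext (fun s => f s y) (fun s => f (s + L1) y) x) by (intros s; symmetry; apply H).
    unfold Derive; f_equal; apply Lim_ext; intros h.
    replace (x + L1 + h) with (x + h + L1) by ring; reflexivity.
  - apply Derive_ext; intros s; apply H.
Qed.

Lemma periodic_dy (L1 L2 : R) (f : R -> R -> R) : periodic L1 L2 f -> periodic L1 L2 (dy f).
Proof.
  intros H x y; unfold dy; split.
  - apply Derive_ext; intros s; apply H.
  - rewrite (Derive_ext (fun s => f x s) (fun s => f x (s + L2)) y) by (intros s; symmetry; apply H).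
    unfold Derive; f_equal; apply Lim_ext; intros h.
    replace (y + L2 + h) with (y + h + L2) by ring; reflexivity.
Qed.

Lemma periodic_const (L1 L2 c : R) : periodic L1 L2 (fun _ _ => c).
Proof. intros x y; split; reflexivity. Qed.

Lemma periodic_plus (L1 L2 : R) (f g : R -> R -> R) : periodic L1 L2 f -> periodic L1 L2 g ->
  periodic L1 L2 (fun x y => f x y + g x y).
Proof.
  intros Hf Hg x y; destruct (Hf x y) as [H1 H2], (Hg x y) as [H3 H4].
  rewrite H1, H2, H3, H4; split; reflexivity.
Qed.

Lemma periodic_mult (L1 L2 : R) (f g : R -> R -> R) : periodic L1 L2 f -> periodic L1 L2 g ->
  periodic L1 L2 (fun x y => f x y * g x y).
Proof.
  intros Hf Hg x y; destruct (Hf x y) as [H1 H2], (Hg x y) as [H3 H4].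
  rewrite H1, H2, H3, H4; split; reflexivity.
Qed.

Lemma periodic_scal (L1 L2 c : R) (f : R -> R -> R) : periodic L1 L2 f ->
  periodic L1 L2 (fun x y => c * f x y).
Proof. intros Hf; apply (periodic_mult _ _ (fun _ _ => c)); [apply periodic_const | exact Hf]. Qed.

Lemma periodic_lap (L1 L2 : R) (f : R -> R -> R) : periodic L1 L2 f -> periodic L1 L2 (lap f).
Proof.
  intros H; apply (periodic_plus _ _ (dx (dx f)) (dy (dy f)));
    [apply periodic_dx, periodic_dx, H | apply periodic_dy, periodic_dy, H].
Qed.

(* Differentiating under the integral reduces this to the fundamental theorem of
   calculus in [x], so no exchange of the order of integration is needed. *)
Lemma iint_dx (L1 L2 : R) (p : R -> R -> R) :
  0 < L2 -> periodic L1 L2 p -> smooth 1 p -> iint L1 L2 (dx p) = 0.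
Proof.
  intros HL2 Hp Hs; unfold iint.
  assert (Hd : forall x, is_derive (fun s => RInt (p s) 0 L2) x (RInt (dx p x) 0 L2)).
  { intros x; apply (is_derive_RInt_param p).
    - apply filter_forall; intros; eapply smooth_ex_dx; exact Hs.
    - intros; apply cont2_pt, (smooth_cont2 0), smooth_dx, Hs.
    - apply filter_forall; intros; apply ex_RInt_y, (smooth_cont2 1), Hs. }
  assert (H : is_RInt (fun x => RInt (dx p x) 0 L2) 0 L1 (RInt (p L1) 0 L2 - RInt (p 0) 0 L2)).
  { apply (is_RInt_derive (V := R_CompleteNormedModule) (fun s => RInt (p s) 0 L2)).
    - intros; apply Hd.
    - intros; apply continuous_RInt_param; [lra | apply (smooth_cont2 0), smooth_dx, Hs]. }
  apply is_RInt_unique in H; etransitivity; [exact H|].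
  apply Rminus_diag_eq, RInt_ext.
  intros y _; rewrite <- (proj1 (Hp 0 y)), Rplus_0_l; reflexivity.
Qed.

Lemma iint_dy (L1 L2 : R) (p : R -> R -> R) :
  periodic L1 L2 p -> smooth 1 p -> iint L1 L2 (dy p) = 0.
Proof.
  intros Hp Hs; unfold iint.
  rewrite (RInt_ext _ (fun _ => 0)).
  - rewrite RInt_const; unfold scal; simpl; unfold mult; simpl; ring.
  - intros x _.
    assert (H : RInt (Derive (p x)) 0 L2 = p x L2 - p x 0).
    { apply RInt_Derive; intros; [eapply smooth_ex_dy, Hs | apply (cont2_y (dy p)), (smooth_cont2 0), smooth_dy, Hs]. }
    etransitivity; [exact H|].
    rewrite <- (proj2 (Hp x 0)), Rplus_0_l; apply Rminus_diag.
Qed.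

Lemma cont2_smooth_1_dx (f : R -> R -> R) : smooth 1 f -> cont2 (dx f).
Proof. intros H; apply (smooth_cont2 0), smooth_dx, H. Qed.

Lemma cont2_smooth_1_dy (f : R -> R -> R) : smooth 1 f -> cont2 (dy f).
Proof. intros H; apply (smooth_cont2 0), smooth_dy, H. Qed.

Lemma smooth_lap (k : nat) (f : R -> R -> R) : smooth (S (S k)) f -> smooth k (lap f).
Proof.
  intros H; apply (smooth_plus k (dx (dx f)) (dy (dy f)));
    [apply smooth_dx, smooth_dx, H | apply smooth_dy, smooth_dy, H].
Qed.

(** The two components of the divergence of u grad w integrate to zero over the cell by periodicity;
    the product rule gives the rest. *)
Lemma iint_green (L1 L2 : R) (u w : R -> R -> R) : 0 < L2 ->
  periodic L1 L2 u -> periodic L1 L2 w -> smooth 1 u -> smooth 2 w ->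
  iint L1 L2 (fun x y => u x y * (- lap w x y))
  = iint L1 L2 (fun x y => dx u x y * dx w x y + dy u x y * dy w x y).
Proof.
  intros HL Pu Pw Su Sw.
  assert (Hx := iint_dx L1 L2 (fun x y => u x y * dx w x y) HL
            (periodic_mult _ _ _ _ Pu (periodic_dx _ _ _ Pw))
            (smooth_mult 1 _ _ Su (smooth_dx _ _ Sw))).
  assert (Hy := iint_dy L1 L2 (fun x y => u x y * dy w x y)
            (periodic_mult _ _ _ _ Pu (periodic_dy _ _ _ Pw))
            (smooth_mult 1 _ _ Su (smooth_dy _ _ Sw))).
  rewrite (dx_mult 0) in Hx by (exact Su || apply smooth_dx, Sw).
  rewrite (dy_mult 0) in Hy by (exact Su || apply smooth_dy, Sw).
  assert (Cu := smooth_cont2 _ _ Su).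
  assert (Cdxu := cont2_smooth_1_dx _ Su). assert (Cdyu := cont2_smooth_1_dy _ Su).
  assert (Sxw := smooth_dx _ _ Sw). assert (Syw := smooth_dy _ _ Sw).
  assert (Cdxw := smooth_cont2 _ _ Sxw). assert (Cdyw := smooth_cont2 _ _ Syw).
  assert (Cxxw := cont2_smooth_1_dx _ Sxw). assert (Cyyw := cont2_smooth_1_dy _ Syw).
  assert (Hsum : iint L1 L2 (fun x y => (dx u x y * dx w x y + u x y * dx (dx w) x y)
                    + (dy u x y * dy w x y + u x y * dy (dy w) x y)) = 0).
  { rewrite iint_plus, Hx, Hy; [ring | exact HL | |];
      apply cont2_plus; apply cont2_mult; assumption. }
  apply Rminus_diag_uniq_sym.
  rewrite <- iint_minus; [| exact HL | |].
  - rewrite <- Hsum; apply iint_ext; intros x y; unfold lap; ring.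
  - apply cont2_plus; apply cont2_mult; assumption.
  - apply cont2_mult; [assumption | apply cont2_opp, (smooth_cont2 0), smooth_lap, Sw].
Qed.

(** * Potentials and the negative norm *)

(** A linear relation between w and v. The mean of w is left free, so that a multiple of the
    chemical potential qualifies as it stands. *)
Definition potential (L1 L2 : R) (w v : R -> R -> R) : Prop :=
  periodic L1 L2 w /\ smooth 2 w /\ forall x y, - lap w x y = v x y.

Lemma potential_ext (L1 L2 : R) (w v v' : R -> R -> R) :
  (forall x y, v x y = v' x y) -> potential L1 L2 w v -> potential L1 L2 w v'.
Proof.
  intros H [Hp [Hs Hl]]; split; [exact Hp | split; [exact Hs|]].
  intros x y; rewrite Hl; apply H.
Qed.

Lemma potential_plus (L1 L2 : R) (w1 w2 v1 v2 : R -> R -> R) :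
  potential L1 L2 w1 v1 -> potential L1 L2 w2 v2 ->
  potential L1 L2 (fun x y => w1 x y + w2 x y) (fun x y => v1 x y + v2 x y).
Proof.
  intros [P1 [S1 E1]] [P2 [S2 E2]]; split; [|split].
  - apply periodic_plus; assumption.
  - apply smooth_plus; assumption.
  - intros x y; unfold lap.
    rewrite (dx_plus 1 w1 w2), (dx_plus 0 (dx w1)), (dy_plus 1 w1 w2), (dy_plus 0 (dy w1))
      by (assumption || (apply smooth_dx; assumption) || (apply smooth_dy; assumption)).
    rewrite <- E1, <- E2; unfold lap; ring.
Qed.

Lemma potential_scal (L1 L2 c : R) (w v : R -> R -> R) : potential L1 L2 w v ->
  potential L1 L2 (fun x y => c * w x y) (fun x y => c * v x y).
Proof.
  intros [P1 [S1 E1]]; split; [|split].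
  - apply periodic_scal; assumption.
  - apply smooth_scal; assumption.
  - intros x y; unfold lap.
    rewrite !dx_scal, !dy_scal, <- E1; unfold lap; ring.
Qed.

Lemma potential_const (L1 L2 c : R) : potential L1 L2 (fun _ _ => c) (fun _ _ => 0).
Proof.
  split; [apply periodic_const | split; [apply smooth_const|]].
  intros x y; unfold lap; rewrite !dx_const, !dy_const; ring.
Qed.

Lemma potential_sum (L1 L2 : R) (w v : nat -> R -> R -> R) (n m : nat) :
  (forall k, (n <= k <= m)%nat -> potential L1 L2 (w k) (v k)) ->
  potential L1 L2 (fun x y => sum_n_m (fun k => w k x y) n m)
                  (fun x y => sum_n_m (fun k => v k x y) n m).
Proof.
  intros H.
  destruct (Nat.lt_ge_cases m n) as [Hlt|Hge].
  { replace (fun x y => sum_n_m (fun k => w k x y) n m) with (fun _ _ : R => 0).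
    - apply potential_ext with (fun _ _ => 0); [|apply potential_const].
      intros x y; rewrite sum_n_m_zero; [reflexivity | exact Hlt].
    - extensionality x; extensionality y; rewrite sum_n_m_zero; [reflexivity | exact Hlt]. }
  induction Hge as [|m Hge IH].
  - replace (fun x y => sum_n_m (fun k => w k x y) n n) with (w n).
    + apply potential_ext with (v n); [|apply H; lia].
      intros x y; rewrite sum_n_n; reflexivity.
    + extensionality x; extensionality y; rewrite sum_n_n; reflexivity.
  - replace (fun x y => sum_n_m (fun k => w k x y) n (S m))
      with (fun x y => sum_n_m (fun k => w k x y) n m + w (S m) x y).
    + apply potential_ext with (fun x y => sum_n_m (fun k => v k x y) n m + v (S m) x y).
      * intros x y; rewrite sum_n_Sm by lia; reflexivity.
      * apply (potential_plus _ _ (fun x y => sum_n_m (fun k => w k x y) n m)).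
        -- apply IH; intros k Hk; apply H; lia.
        -- apply H; lia.
    + extensionality x; extensionality y; rewrite sum_n_Sm by lia; reflexivity.
Qed.

Lemma dx_sum (w : nat -> R -> R -> R) (n m : nat) (x y : R) :
  (forall k, (n <= k <= m)%nat -> smooth 1 (w k)) ->
  dx (fun x y => sum_n_m (fun k => w k x y) n m) x y = sum_n_m (fun k => dx (w k) x y) n m.
Proof.
  intros H; unfold dx.
  apply is_derive_unique.
  destruct (Nat.lt_ge_cases m n) as [Hlt|Hge].
  { rewrite sum_n_m_zero by exact Hlt.
    apply is_derive_ext with (fun _ => 0).
    - intros s; rewrite sum_n_m_zero; [reflexivity | exact Hlt].
    - exact (is_derive_const 0 x). }
  induction Hge as [|m Hge IH].
  - rewrite sum_n_n; apply is_derive_ext with (fun s => w n s y).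
    + intros s; rewrite sum_n_n; reflexivity.
    + apply Derive_correct, (smooth_ex_dx 0), H; lia.
  - rewrite sum_n_Sm by lia.
    apply is_derive_ext with (fun s => plus (sum_n_m (fun k => w k s y) n m) (w (S m) s y)).
    + intros s; rewrite sum_n_Sm by lia; reflexivity.
    + apply (is_derive_plus (fun s => sum_n_m (fun k => w k s y) n m) (fun s => w (S m) s y)).
      * apply IH; intros k Hk; apply H; lia.
      * apply Derive_correct, (smooth_ex_dx 0), H; lia.
Qed.

Lemma dy_sum (w : nat -> R -> R -> R) (n m : nat) (x y : R) :
  (forall k, (n <= k <= m)%nat -> smooth 1 (w k)) ->
  dy (fun x y => sum_n_m (fun k => w k x y) n m) x y = sum_n_m (fun k => dy (w k) x y) n m.
Proof.
  intros H; unfold dy.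
  apply is_derive_unique.
  destruct (Nat.lt_ge_cases m n) as [Hlt|Hge].
  { rewrite sum_n_m_zero by exact Hlt.
    apply is_derive_ext with (fun _ => 0).
    - intros s; rewrite sum_n_m_zero; [reflexivity | exact Hlt].
    - exact (is_derive_const 0 y). }
  induction Hge as [|m Hge IH].
  - rewrite sum_n_n; apply is_derive_ext with (fun s => w n x s).
    + intros s; rewrite sum_n_n; reflexivity.
    + apply Derive_correct, (smooth_ex_dy 0), H; lia.
  - rewrite sum_n_Sm by lia.
    apply is_derive_ext with (fun s => plus (sum_n_m (fun k => w k x s) n m) (w (S m) x s)).
    + intros s; rewrite sum_n_Sm by lia; reflexivity.
    + apply (is_derive_plus (fun s => sum_n_m (fun k => w k x s) n m) (fun s => w (S m) x s)).
      * apply IH; intros k Hk; apply H; lia.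
      * apply Derive_correct, (smooth_ex_dy 0), H; lia.
Qed.

(** The choice in [inv_neg_lap] satisfies its specification as soon as one function does.
    Subtracting its mean from any potential w produces such a function. *)
Lemma inv_neg_lap_potential (L1 L2 : R) (w v : R -> R -> R) : 0 < L1 -> 0 < L2 ->
  potential L1 L2 w v -> potential L1 L2 (inv_neg_lap L1 L2 v) v.
Proof.
  intros HL1 HL2 Hw.
  pose (c := - (iint L1 L2 w / (L1 * L2))).
  assert (Hc : potential L1 L2 (fun x y => w x y + c) v).
  { apply potential_ext with (fun x y => v x y + 0); [intros; ring|].
    apply (potential_plus _ _ w (fun _ _ => c)); [exact Hw | apply potential_const]. }
  assert (Hex : exists u, periodic L1 L2 u /\ Ck 2 u /\ ip L1 L2 u (fun _ _ => 1) = 0 /\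
                 forall x y, - lap u x y = v x y).
  { exists (fun x y => w x y + c); destruct Hc as [P [Sm E]].
    split; [exact P | split; [apply smooth_Ck, Sm | split; [|exact E]]].
    change (iint L1 L2 (fun x y => (w x y + c) * 1) = 0).
    rewrite (iint_ext _ _ _ (fun x y => w x y + c)) by (intros; ring).
    rewrite (iint_plus L1 L2 w (fun _ _ => c));
      [| exact HL2 | eapply smooth_cont2; apply Hw | apply cont2_const].
    rewrite iint_const; unfold c; field; split; lra. }
  destruct (epsilon_spec (inhabits (fun _ _ => 0)) _ Hex) as [P [Sm [_ E]]].
  split; [exact P | split; [apply Ck_smooth, Sm | exact E]].
Qed.

(* Moving the Laplacian across twice shows that any potential of [v] computes the
   H^{-1} norm, so uniqueness of the inverse Laplacian is not needed. *)
Lemma norm_m1_sqr (L1 L2 : R) (w v : R -> R -> R) : 0 < L1 -> 0 < L2 ->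
  potential L1 L2 w v ->
  norm_m1 L1 L2 v ^ 2 = iint L1 L2 (fun x y => dx w x y ^ 2 + dy w x y ^ 2).
Proof.
  intros HL1 HL2 Hw.
  destruct (inv_neg_lap_potential _ _ _ _ HL1 HL2 Hw) as [Pi [Si Ei]].
  destruct Hw as [P [Sm E]].
  assert (H : ip_m1 L1 L2 v v = iint L1 L2 (fun x y => dx w x y ^ 2 + dy w x y ^ 2)).
  { change (iint L1 L2 (fun x y => inv_neg_lap L1 L2 v x y * v x y)
            = iint L1 L2 (fun x y => dx w x y ^ 2 + dy w x y ^ 2)).
    rewrite (iint_ext _ _ _ (fun x y => inv_neg_lap L1 L2 v x y * - lap w x y))
      by (intros; rewrite E; reflexivity).
    rewrite iint_green by (assumption || apply smooth_pred; assumption).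
    rewrite (iint_ext _ _ _ (fun x y => dx w x y * dx (inv_neg_lap L1 L2 v) x y
               + dy w x y * dy (inv_neg_lap L1 L2 v) x y)) by (intros; ring).
    rewrite <- iint_green by (assumption || apply smooth_pred; assumption).
    rewrite (iint_ext _ _ _ (fun x y => w x y * - lap w x y))
      by (intros; rewrite E, Ei; reflexivity).
    rewrite iint_green by (assumption || apply smooth_pred; assumption).
    apply iint_ext; intros; ring. }
  unfold norm_m1; rewrite H, <- Rsqr_pow2, Rsqr_sqrt; [reflexivity|].
  apply iint_ge_0; try assumption.
  - apply cont2_plus; apply cont2_pow;
      [apply cont2_smooth_1_dx | apply cont2_smooth_1_dy]; apply smooth_pred, Sm.
  - intros; apply Rplus_le_le_0_compat; apply pow2_ge_0.
Qed.

(** * Real powers and the Gamma function *)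

Lemma Rpower_pos (x y : R) : 0 < Rpower x y.
Proof. apply exp_pos. Qed.

Lemma is_derive_Rpower (x z : R) :
  0 < x -> is_derive (fun s => Rpower s z) x (z * Rpower x (z - 1)).
Proof. intros Hx; apply is_derive_Reals, derivable_pt_lim_power, Hx. Qed.

Lemma continuous_Rpower (x z : R) : 0 < x -> continuous (fun s => Rpower s z) x.
Proof.
  intros Hx; apply (ex_derive_continuous (fun s => Rpower s z)).
  eexists; apply is_derive_Rpower, Hx.
Qed.

Lemma Rpower_succ (x z : R) : 0 < x -> Rpower x z = x * Rpower x (z - 1).
Proof.
  intros Hx; rewrite <- (Rpower_1 x Hx) at 2; rewrite <- Rpower_plus; f_equal; ring.
Qed.

Lemma Rpower_le_antitone (x y z : R) : 0 <= z -> 0 < x <= y -> Rpower y (- z) <= Rpower x (- z).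
Proof.
  intros Hz Hxy; rewrite !Rpower_Ropp.
  apply Rinv_le_contravar; [apply Rpower_pos | apply Rle_Rpower_l; assumption].
Qed.

Lemma Rpower_at_right_0 (z : R) : 0 < z ->
  filterlim (fun s => Rpower s z) (at_right 0) (locally 0).
Proof.
  intros Hz; apply (proj2 (filterlim_locally _ _)); intros eps.
  exists (mkposreal _ (Rpower_pos eps (/ z))); intros s Hs Hs0.
  unfold ball in *; simpl in *; unfold AbsRing_ball, abs, minus, plus, opp in *; simpl in *.
  rewrite Ropp_0, Rplus_0_r in *.
  rewrite Rabs_pos_eq in * by (left; (exact Hs0 || apply Rpower_pos)).
  replace (pos eps) with (Rpower (Rpower eps (/ z)) z).
  - apply Rlt_Rpower_l; lra.
  - rewrite Rpower_mult, Rinv_l, Rpower_1; [reflexivity | apply cond_pos | lra].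
Qed.

(** Fundamental theorem for improper integrals: the antiderivative needs only limits along the two
    filters. It serves the Gamma integral at 0 and at infinity, and the kernels at their singular
    endpoint. *)
Lemma is_RInt_gen_antideriv (Fa Fb : (R -> Prop) -> Prop) {FFa : Filter Fa} {FFb : Filter Fb}
    (F f : R -> R) (la lb : R) :
  filter_prod Fa Fb (fun ab => is_RInt f (fst ab) (snd ab) (F (snd ab) - F (fst ab))) ->
  filterlim F Fa (locally la) -> filterlim F Fb (locally lb) ->
  is_RInt_gen f Fa Fb (lb - la).
Proof.
  intros HI Ha Hb P HP.
  assert (Hl : filterlim (fun ab : R * R => F (snd ab) - F (fst ab)) (filter_prod Fa Fb)
                 (locally (lb - la))).
  { apply (filterlim_comp_2 (F := filter_prod Fa Fb) (G := locally lb) (H := locally (- la))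
             (fun ab => F (snd ab)) (fun ab => - F (fst ab)) Rplus).
    - eapply filterlim_comp; [apply filterlim_snd | exact Hb].
    - eapply filterlim_comp; [eapply filterlim_comp; [apply filterlim_fst | exact Ha]|].
      apply (filterlim_opp la).
    - apply (filterlim_plus lb (- la)). }
  specialize (Hl P HP); unfold filtermap in Hl.
  unfold filtermapi.
  eapply filter_imp; [|apply (filter_and _ _ HI Hl)].
  intros ab [H1 H2]; exists (F (snd ab) - F (fst ab)); split; assumption.
Qed.

Lemma filter_prod_pos (P : R * R -> Prop) :
  (forall a b, 0 < a -> 0 < b -> P (a, b)) -> filter_prod (at_right 0) (Rbar_locally p_infty) P.
Proof.
  intros H; apply (Filter_prod _ _ _ (fun a => 0 < a) (fun b => 0 < b)).
  - exists (mkposreal 1 Rlt_0_1); intros y _ Hy; exact Hy.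
  - exists 0; intros y Hy; exact Hy.
  - exact H.
Qed.

Lemma Rmin_Rmax_pos (a b x : R) : 0 < a -> 0 < b -> Rmin a b <= x <= Rmax a b -> 0 < x.
Proof.
  intros Ha Hb [Hx _]; apply Rlt_le_trans with (Rmin a b); [apply Rmin_glb_lt|]; assumption.
Qed.

Lemma continuous_exp_opp (x : R) : continuous (fun s => exp (- s)) x.
Proof.
  apply (ex_derive_continuous (fun s => exp (- s))); auto_derive; exact I.
Qed.

Lemma Gamma_integrand_continuous (z s : R) :
  0 < s -> continuous (fun s => Rpower s z * exp (- s)) s.
Proof.
  intros Hs; apply (continuous_mult (fun s => Rpower s z)).
  - apply continuous_Rpower, Hs.
  - apply continuous_exp_opp.
Qed.

Lemma Gamma_integrand_pos (z s : R) : 0 < Rpower s z * exp (- s).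
Proof. apply Rmult_lt_0_compat; [apply Rpower_pos | apply exp_pos]. Qed.

Lemma Gamma_boundary_at_right_0 (z : R) : 0 < z ->
  filterlim (fun s => Rpower s z * exp (- s)) (at_right 0) (locally 0).
Proof.
  intros Hz.
  apply (filterlim_le_le (fun _ => 0) (fun s => Rpower s z * exp (- s))
           (fun s => Rpower s z) (Finite 0)).
  - exists (mkposreal 1 Rlt_0_1); intros s _ Hs; split; [left; apply Gamma_integrand_pos|].
    rewrite <- (Rmult_1_r (Rpower s z)) at 2.
    apply Rmult_le_compat_l; [left; apply Rpower_pos|].
    rewrite <- exp_0; left; apply exp_increasing; lra.
  - apply filterlim_const.
  - apply Rpower_at_right_0, Hz.
Qed.

(* [exp s = exp (s / 3) ^ 3 >= (s / 3) ^ 3]. *)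
Lemma Gamma_boundary_p_infty (z : R) : z <= 2 ->
  filterlim (fun s => Rpower s z * exp (- s)) (Rbar_locally p_infty) (locally 0).
Proof.
  intros Hz.
  apply (filterlim_le_le (fun _ => 0) (fun s => Rpower s z * exp (- s))
           (fun s => 27 * / s) (Finite 0)).
  - exists 1; intros s Hs; split; [left; apply Gamma_integrand_pos|].
    assert (H1 : Rpower s z <= s ^ 2).
    { rewrite <- Rpower_pow by lra; apply Rle_Rpower; simpl; lra. }
    assert (H2 : (s / 3) ^ 3 <= exp s).
    { replace s with (s / 3 + (s / 3 + s / 3)) at 2 by field.
      rewrite !exp_plus.
      assert (H3 : s / 3 <= exp (s / 3)) by (generalize (exp_ineq1_le (s / 3)); lra).
      replace ((s / 3) ^ 3) with (s / 3 * (s / 3 * (s / 3))) by ring.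
      repeat (apply Rmult_le_compat; try (repeat apply Rmult_le_pos; lra); try exact H3). }
    rewrite exp_Ropp.
    apply Rle_trans with (s ^ 2 * / (s / 3) ^ 3).
    + apply Rmult_le_compat; [left; apply Rpower_pos | left; apply Rinv_0_lt_compat, exp_pos
        | exact H1 |].
      apply Rinv_le_contravar; [apply pow_lt; lra | exact H2].
    + right; field; lra.
  - apply filterlim_const.
  - replace (Finite 0) with (Rbar_mult 27 (Rbar_inv p_infty)) by (simpl; f_equal; ring).
    change (is_lim (fun s => 27 * / s) p_infty (Rbar_mult 27 (Rbar_inv p_infty))).
    apply is_lim_scal_l, (is_lim_inv (fun s => s)); [apply is_lim_id | discriminate].
Qed.

(** Integration by parts: the derivative of [s^z exp(-s)] has integral zero because both boundary
    limits vanish. Convergence at z is assumed so that [Gamma z] is the true value of its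
    integral. *)
Lemma is_RInt_gen_Gamma_succ (z : R) : 0 < z <= 2 ->
  ex_RInt_gen (fun s => Rpower s (z - 1) * exp (- s)) (at_right 0) (Rbar_locally p_infty) ->
  is_RInt_gen (fun s => Rpower s z * exp (- s)) (at_right 0) (Rbar_locally p_infty)
    (z * Gamma z).
Proof.
  intros Hz Hex.
  assert (HG : is_RInt_gen (fun s => Rpower s (z - 1) * exp (- s)) (at_right 0)
                 (Rbar_locally p_infty) (Gamma z)).
  { exact (RInt_gen_correct (V := R_CompleteNormedModule) _ Hex). }
  assert (HB : is_RInt_gen (fun s => z * (Rpower s (z - 1) * exp (- s)) - Rpower s z * exp (- s))
                 (at_right 0) (Rbar_locally p_infty) (0 - 0)).
  { apply (is_RInt_gen_antideriv _ _ (fun s => Rpower s z * exp (- s))).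
    - apply filter_prod_pos; intros a b Ha Hb; simpl.
      apply (is_RInt_derive (V := R_CompleteNormedModule) (fun s => Rpower s z * exp (- s))).
      + intros x Hx; apply (Rmin_Rmax_pos _ _ _ Ha Hb) in Hx.
        replace (z * (Rpower x (z - 1) * exp (- x)) - Rpower x z * exp (- x))
          with (z * Rpower x (z - 1) * exp (- x) + Rpower x z * (- exp (- x))) by ring.
        apply (is_derive_mult (fun s => Rpower s z) (fun s => exp (- s)));
          [apply is_derive_Rpower, Hx | | intros; apply Rmult_comm].
        auto_derive; [exact I | ring].
      + intros x Hx; apply (Rmin_Rmax_pos _ _ _ Ha Hb) in Hx.
        apply (continuous_minus (fun s => z * (Rpower s (z - 1) * exp (- s)))).
        * apply (continuous_scal_r z (fun s => Rpower s (z - 1) * exp (- s))).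
          apply Gamma_integrand_continuous, Hx.
        * apply Gamma_integrand_continuous, Hx.
    - apply Gamma_boundary_at_right_0; lra.
    - apply Gamma_boundary_p_infty; lra. }
  replace (z * Gamma z) with (minus (scal z (Gamma z)) (0 - 0))
    by (unfold minus, plus, opp, scal; simpl; unfold mult; simpl; ring).
  assert (HM := is_RInt_gen_minus _ _ _ _ (is_RInt_gen_scal _ z _ HG) HB).
  eapply is_RInt_gen_ext; [|exact HM].
  apply filter_forall; intros ab x _.
  unfold minus, plus, opp, scal; simpl; unfold mult; simpl; ring.
Qed.

Lemma Gamma_succ (z : R) : 0 < z <= 2 ->
  ex_RInt_gen (fun s => Rpower s (z - 1) * exp (- s)) (at_right 0) (Rbar_locally p_infty) ->
  Gamma (z + 1) = z * Gamma z.
Proof.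
  intros Hz Hex; unfold Gamma at 1.
  replace (z + 1 - 1) with z by ring.
  apply is_RInt_gen_unique, is_RInt_gen_Gamma_succ; assumption.
Qed.

(** * Convergence and positivity of the Gamma integral *)

Lemma monotone_bounded_cv_p_infty (F : R -> R) (M : R) :
  (forall x y, 1 <= x <= y -> F x <= F y) -> (forall x, 1 <= x -> F x <= M) ->
  exists l, F 1 <= l /\ filterlim F (Rbar_locally p_infty) (locally l).
Proof.
  intros Hm HM.
  destruct (completeness (fun v => exists x, 1 <= x /\ v = F x)) as [l [Hub Hlub]].
  { exists M; intros v [x [Hx ->]]; apply HM, Hx. }
  { exists (F 1), 1; split; [lra | reflexivity]. }
  exists l; split; [apply Hub; exists 1; split; [lra | reflexivity]|].
  apply (proj2 (filterlim_locally _ _)); intros eps.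
  destruct (Classical_Prop.classic (exists x, 1 <= x /\ l - eps < F x)) as [[x [Hx Hl]]|Hn].
  - exists x; intros y Hy.
    assert (F x <= F y) by (apply Hm; lra).
    assert (F y <= l) by (apply Hub; exists y; split; [lra | reflexivity]).
    unfold ball; simpl; unfold AbsRing_ball, abs, minus, plus, opp; simpl.
    apply Rabs_def1; destruct eps; simpl in *; lra.
  - exfalso.
    assert (l <= l - eps); [|destruct eps; simpl in *; lra].
    apply Hlub; intros v [x [Hx ->]].
    apply Rnot_lt_le; intros Hlt; apply Hn; exists x; split; assumption.
Qed.

(** The substitution x to 1/x carries 0+ to infinity and reverses monotonicity. *)
Lemma antitone_bounded_cv_at_right_0 (F : R -> R) (M : R) :
  (forall x y, 0 < x -> x <= y <= 1 -> F y <= F x) -> (forall x, 0 < x <= 1 -> F x <= M) ->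
  exists l, F 1 <= l /\ filterlim F (at_right 0) (locally l).
Proof.
  intros Hm HM.
  assert (Hinv : forall x, 1 <= x -> 0 < / x <= 1).
  { intros x Hx; split; [apply Rinv_0_lt_compat; lra|].
    rewrite <- Rinv_1; apply Rinv_le_contravar; lra. }
  destruct (monotone_bounded_cv_p_infty (fun x => F (/ x)) M) as [l [Hl Hlim]].
  - intros x y Hxy; apply Hm; [apply Hinv; lra|]; split; [apply Rinv_le_contravar; lra|].
    apply Hinv; lra.
  - intros x Hx; apply HM, Hinv, Hx.
  - exists l; rewrite Rinv_1 in Hl; split; [exact Hl|].
    apply filterlim_ext with (fun s => F (/ / s)).
    + intros s; rewrite Rinv_inv; reflexivity.
    + eapply (filterlim_comp _ _ _ Rinv (fun x => F (/ x))); [apply filterlim_Rinv_0_right | exact Hlim].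
Qed.

(** The integrand is at most [exp(-s)] on [1, oo) and at most [s^(z-1)] on (0, 1], which bounds the
    partial integrals by 1 and 1/z. The piece over [1, 2] makes the limit positive. *)
Lemma is_RInt_gen_Gamma (z : R) : 0 < z < 1 -> exists l, 0 < l /\
  is_RInt_gen (fun s => Rpower s (z - 1) * exp (- s)) (at_right 0) (Rbar_locally p_infty) l.
Proof.
  intros Hz.
  set (f := fun s => Rpower s (z - 1) * exp (- s)).
  assert (Hc : forall x, 0 < x -> continuous f x) by (intros; apply Gamma_integrand_continuous; assumption).
  assert (Hex : forall a b, 0 < a -> 0 < b -> ex_RInt f a b).
  { intros a b Ha Hb; apply (ex_RInt_continuous (V := R_CompleteNormedModule)).
    intros x Hx; apply Hc, (Rmin_Rmax_pos a b); assumption. }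
  assert (Hpos : forall a b, 0 < a <= b -> 0 <= RInt f a b).
  { intros a b Hab; apply RInt_ge_0; [lra | apply Hex; lra |].
    intros; left; apply Gamma_integrand_pos. }
  assert (Hch : forall a b c, 0 < a -> 0 < b -> 0 < c -> RInt f a b + RInt f b c = RInt f a c).
  { intros a b c Ha Hb Hc'; apply (RInt_Chasles (V := R_CompleteNormedModule)); apply Hex; assumption. }
  assert (Hder : forall F g a b, 0 < a <= b -> (forall x, 0 < x -> is_derive F x (g x)) ->
            (forall x, 0 < x -> continuous g x) -> (forall x, a < x < b -> f x <= g x) ->
            RInt f a b <= F b - F a).
  { intros F g a b Hab HF Hg Hfg.
    assert (HI : is_RInt g a b (F b - F a)).
    { apply (is_RInt_derive (V := R_CompleteNormedModule) F); intros x Hx;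
        [apply HF | apply Hg]; apply (Rmin_Rmax_pos a b); lra. }
    rewrite <- (is_RInt_unique _ _ _ _ HI).
    apply RInt_le; [lra | apply Hex; lra | eexists; exact HI | exact Hfg]. }
  destruct (monotone_bounded_cv_p_infty (fun b => RInt f 1 b) 1) as [l2 [Hl2 Hlim2]].
  { intros x y Hxy; rewrite <- (Hch 1 x y) by lra. generalize (Hpos x y); lra. }
  { intros x Hx.
    apply Rle_trans with (- exp (- x) - - exp (- 1)).
    - apply (Hder (fun s => - exp (- s)) (fun s => exp (- s))); [lra | | |].
      + intros s _; auto_derive; [exact I | ring].
      + intros s _; apply continuous_exp_opp.
      + intros s Hs; unfold f; rewrite <- (Rmult_1_l (exp (- s))) at 2.
        apply Rmult_le_compat_r; [left; apply exp_pos|].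
        replace (z - 1) with (- (1 - z)) by ring.
        replace 1 with (Rpower 1 (- (1 - z))) at 2 by (unfold Rpower; rewrite ln_1, Rmult_0_r; apply exp_0).
        apply Rpower_le_antitone; lra.
    - generalize (exp_pos (- x)); assert (exp (- 1) < exp 0) by (apply exp_increasing; lra).
      rewrite exp_0 in *; lra. }
  destruct (antitone_bounded_cv_at_right_0 (fun a => RInt f a 1) (/ z)) as [l1 [Hl1 Hlim1]].
  { intros x y Hx Hxy; rewrite <- (Hch x y 1) by lra. generalize (Hpos x y); lra. }
  { intros x Hx.
    apply Rle_trans with (/ z * Rpower 1 z - / z * Rpower x z).
    - apply (Hder (fun s => / z * Rpower s z) (fun s => Rpower s (z - 1))); [lra | | |].
      + intros s Hs.
        replace (Rpower s (z - 1)) with (/ z * (z * Rpower s (z - 1))) by (field; lra).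
        apply (is_derive_scal (fun s => Rpower s z)), is_derive_Rpower, Hs.
      + intros s Hs; apply continuous_Rpower, Hs.
      + intros s Hs; unfold f; rewrite <- (Rmult_1_r (Rpower s (z - 1))) at 2.
        apply Rmult_le_compat_l; [left; apply Rpower_pos|].
        rewrite <- exp_0; left; apply exp_increasing; lra.
    - assert (0 < / z) by (apply Rinv_0_lt_compat; lra).
      assert (0 < / z * Rpower x z) by (apply Rmult_lt_0_compat; [assumption | apply Rpower_pos]).
      replace (Rpower 1 z) with 1 by (unfold Rpower; rewrite ln_1, Rmult_0_r; symmetry; apply exp_0).
      lra. }
  rewrite RInt_point in Hl1.
  assert (Hl : l2 - (- l1) = l1 + l2) by ring.
  (* The antiderivative [RInt f 1] tends to [- l1] at 0 and to [l2] at infinity. *)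
  exists (l2 - (- l1)); split.
  - assert (0 < RInt f 1 2).
    { apply RInt_gt_0; [lra | intros; apply Gamma_integrand_pos | intros; apply Hc; lra]. }
    assert (RInt f 1 2 <= l2); [|unfold zero in Hl1; simpl in Hl1; lra].
    apply (filterlim_le (F := Rbar_locally p_infty) (fun _ => RInt f 1 2) (fun b => RInt f 1 b)
             (Finite (RInt f 1 2)) (Finite l2)).
    + exists 2; intros x Hx; rewrite <- (Hch 1 2 x) by lra. generalize (Hpos 2 x); lra.
    + apply filterlim_const.
    + exact Hlim2.
  - apply (is_RInt_gen_antideriv _ _ (fun x => RInt f 1 x)).
    + apply filter_prod_pos; intros a b Ha Hb; simpl.
      replace (RInt f 1 b - RInt f 1 a) with (RInt f a b)
        by (rewrite <- (Hch 1 a b Rlt_0_1 Ha Hb); symmetry; apply Rplus_minus_l).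
      apply (RInt_correct (V := R_CompleteNormedModule)), Hex; assumption.
    + apply filterlim_ext_loc with (fun a => - RInt f a 1).
      * exists (mkposreal 1 Rlt_0_1); intros a _ Ha.
        generalize (Hch 1 a 1 Rlt_0_1 Ha Rlt_0_1); rewrite RInt_point; unfold zero; simpl; lra.
      * eapply filterlim_comp; [exact Hlim1 | apply (filterlim_opp l1)].
    + exact Hlim2.
Qed.

Lemma Gamma_pos (z : R) : 0 < z < 1 -> 0 < Gamma z.
Proof.
  intros Hz; destruct (is_RInt_gen_Gamma z Hz) as [l [Hl HI]].
  unfold Gamma; rewrite (is_RInt_gen_unique _ _ HI); exact Hl.
Qed.

(** With z = 1 - al this relates the Gamma(3 - al) of the energy to the Gamma(1 - al) inside
    [omega]. *)
Lemma Gamma_succ_succ (z : R) : 0 < z < 1 -> Gamma (z + 2) = (z + 1) * z * Gamma z.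
Proof.
  intros Hz; destruct (is_RInt_gen_Gamma z Hz) as [l [Hl HI]].
  assert (Hex : ex_RInt_gen (fun s => Rpower s (z - 1) * exp (- s)) (at_right 0)
                  (Rbar_locally p_infty)) by (exists l; exact HI).
  replace (z + 2) with (z + 1 + 1) by ring.
  rewrite Gamma_succ, Gamma_succ; [ring | lra | exact Hex | lra |].
  exists (z * Gamma z); replace (z + 1 - 1) with z by ring.
  apply is_RInt_gen_Gamma_succ; [lra | exact Hex].
Qed.

(* With [q ^ 3 = (7 + 3 sqrt 5) / 2] the two cube roots are [3 / q] and [q], so that
   [3 Rstar = q + 1 / q - 1] and [q ^ 3 + 1 / q ^ 3 = 7]. *)
Lemma Rstar_root : 0 < Rstar /\ 3 * Rstar ^ 2 * (1 + Rstar) = 1.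
Proof.
  assert (Hs : sqrt 5 ^ 2 = 5) by (apply pow2_sqrt; lra).
  assert (Hs0 : 0 <= sqrt 5) by apply sqrt_pos.
  assert (Hs7 : sqrt 5 < 7 / 3) by nra.
  set (q := Rpower ((7 + 3 * sqrt 5) / 2) (/ 3)).
  assert (Hq : 0 < q) by apply Rpower_pos.
  assert (Hq3 : q ^ 3 = (7 + 3 * sqrt 5) / 2).
  { unfold q; rewrite <- Rpower_pow by apply Rpower_pos; rewrite Rpower_mult.
    replace (/ 3 * INR 3) with 1 by (simpl; field); apply Rpower_1; lra. }
  set (p := Rpower ((189 - 81 * sqrt 5) / 2) (/ 3)).
  assert (Hp : p = 3 / q).
  { assert (Hpq : p * q = 3).
    { unfold p, q; rewrite Rpower_mult_distr by lra.
      replace ((189 - 81 * sqrt 5) / 2 * ((7 + 3 * sqrt 5) / 2)) with (3 ^ 3) by nra.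
      rewrite <- Rpower_pow, Rpower_mult by lra.
      replace (INR 3 * / 3) with 1 by (simpl; field); apply Rpower_1; lra. }
    rewrite <- Hpq; field; lra. }
  assert (HR : Rstar = (q + / q - 1) / 3).
  { unfold Rstar; fold p q; rewrite Hp; field; lra. }
  assert (Hu : 2 <= q + / q).
  { apply Rmult_le_reg_r with q; [exact Hq|].
    rewrite Rmult_plus_distr_r, Rinv_l by lra.
    assert (0 <= (q - 1) ^ 2) by apply pow2_ge_0; lra. }
  split; [lra|].
  assert (H7 : q ^ 3 + / q ^ 3 = 7).
  { rewrite Hq3.
    replace (/ ((7 + 3 * sqrt 5) / 2)) with ((7 - 3 * sqrt 5) / 2); [field|].
    apply Rmult_eq_reg_r with ((7 + 3 * sqrt 5) / 2); [|lra].
    rewrite Rinv_l by lra; nra. }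
  replace (q ^ 3 + / q ^ 3) with ((q + / q) ^ 3 - 3 * (q + / q)) in H7 by (field; lra).
  rewrite HR; nra.
Qed.

(** The cubic [3 r^2 (1 + r)] increases for r > 0 and equals 1 at [Rstar]; the kernel estimates use
    the lower ratio bound in this form. *)
Lemma Rstar_le_cubic (r : R) : Rstar <= r -> 0 < r /\ 1 <= 3 * r ^ 2 * (1 + r).
Proof.
  destruct Rstar_root as [H0 H1]; intros Hr; split; [lra|].
  rewrite <- H1.
  assert (Rstar ^ 2 <= r ^ 2) by (apply pow_incr; lra).
  assert (0 < Rstar ^ 2) by (apply pow_lt; lra).
  apply Rmult_le_compat; lra.
Qed.

(** * Averages and first moments of convex functions *)

(** For k < n, [akern] and [etakern] are [avg] and [moment] of [omega(t_n - s)] over step k. The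
    weight of [moment] is odd about the midpoint, so constants do not contribute to it. *)
Definition avg (p q : R) (K : R -> R) : R := / (q - p) * RInt K p q.

Definition moment (p q : R) (K : R -> R) : R :=
  2 / (q - p) * RInt (fun s => (s - (q + p) / 2) / (q - p) * K s) p q.

Lemma ex_RInt_cont (f : R -> R) (p q : R) : p <= q ->
  (forall s, p <= s <= q -> continuous f s) -> ex_RInt f p q.
Proof.
  intros Hpq Hf; apply (ex_RInt_continuous (V := R_CompleteNormedModule)).
  intros s Hs; apply Hf; rewrite Rmin_left, Rmax_right in Hs; assumption.
Qed.

Lemma is_RInt_FTC (F f : R -> R) (p q : R) : p <= q ->
  (forall s, p <= s <= q -> is_derive F s (f s)) ->
  (forall s, p <= s <= q -> continuous f s) -> is_RInt f p q (F q - F p).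
Proof.
  intros Hpq HF Hf.
  apply (is_RInt_derive (V := R_CompleteNormedModule) F f);
    rewrite Rmin_left, Rmax_right by exact Hpq; assumption.
Qed.

Lemma RInt_le_FTC (F f g : R -> R) (p q : R) : p <= q ->
  (forall s, p <= s <= q -> is_derive F s (g s)) ->
  (forall s, p <= s <= q -> continuous g s) ->
  (forall s, p <= s <= q -> continuous f s) ->
  (forall s, p < s < q -> f s <= g s) -> RInt f p q <= F q - F p.
Proof.
  intros Hpq HF Hg Hf H.
  rewrite <- (is_RInt_unique _ _ _ _ (is_RInt_FTC F g p q Hpq HF Hg)).
  apply RInt_le; [exact Hpq | apply ex_RInt_cont; assumption
    | apply ex_RInt_cont; assumption | exact H].
Qed.

Lemma RInt_ge_FTC (F f g : R -> R) (p q : R) : p <= q ->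
  (forall s, p <= s <= q -> is_derive F s (g s)) ->
  (forall s, p <= s <= q -> continuous g s) ->
  (forall s, p <= s <= q -> continuous f s) ->
  (forall s, p < s < q -> g s <= f s) -> F q - F p <= RInt f p q.
Proof.
  intros Hpq HF Hg Hf H.
  rewrite <- (is_RInt_unique _ _ _ _ (is_RInt_FTC F g p q Hpq HF Hg)).
  apply RInt_le; [exact Hpq | apply ex_RInt_cont; assumption
    | apply ex_RInt_cont; assumption | exact H].
Qed.

Lemma continuous_affine (a b x : R) : continuous (fun s => a + b * s) x.
Proof.
  apply (ex_derive_continuous (fun s => a + b * s)); auto_derive; exact I.
Qed.

Lemma continuous_moment (p q x : R) (K : R -> R) : continuous K x ->
  continuous (fun s => (s - (q + p) / 2) / (q - p) * K s) x.
Proof.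
  intros HK; apply (continuous_mult (fun s => (s - (q + p) / 2) / (q - p)) K); [|exact HK].
  apply continuous_ext with (fun s => - ((q + p) / 2) * / (q - p) + / (q - p) * s).
  - intros s; unfold Rdiv; simpl; ring.
  - apply continuous_affine.
Qed.

Lemma avg_minus (p q : R) (K L : R -> R) : p < q ->
  (forall s, p <= s <= q -> continuous K s) -> (forall s, p <= s <= q -> continuous L s) ->
  avg p q (fun s => K s - L s) = avg p q K - avg p q L.
Proof.
  intros Hpq HK HL; unfold avg.
  assert (H : RInt (fun s => K s - L s) p q = RInt K p q - RInt L p q).
  { apply (RInt_minus (V := R_CompleteNormedModule) K L); apply ex_RInt_cont; auto; lra. }
  rewrite H; ring.
Qed.

Lemma moment_minus (p q : R) (K L : R -> R) : p < q ->
  (forall s, p <= s <= q -> continuous K s) -> (forall s, p <= s <= q -> continuous L s) ->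
  moment p q (fun s => K s - L s) = moment p q K - moment p q L.
Proof.
  intros Hpq HK HL; unfold moment.
  assert (H : RInt (fun s => (s - (q + p) / 2) / (q - p) * (K s - L s)) p q
              = RInt (fun s => (s - (q + p) / 2) / (q - p) * K s) p q
                - RInt (fun s => (s - (q + p) / 2) / (q - p) * L s) p q).
  { rewrite <- (RInt_minus (V := R_CompleteNormedModule)
                  (fun s => (s - (q + p) / 2) / (q - p) * K s)
                  (fun s => (s - (q + p) / 2) / (q - p) * L s))
      by (apply ex_RInt_cont; [lra | intros; apply continuous_moment; auto]).
    apply RInt_ext; intros s _; unfold minus, plus, opp; simpl; ring. }
  rewrite H; ring.
Qed.

(** The combined weight has mean 1 over [p, q], and it is nonnegative when 0 <= th <= 1 since the
    normalised variable stays within [-1/2, 1/2]. *)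
Lemma avg_moment (p q th : R) (K : R -> R) : p < q ->
  (forall s, p <= s <= q -> continuous K s) ->
  avg p q K - th * moment p q K
  = / (q - p) * RInt (fun s => (1 - 2 * th * ((s - (q + p) / 2) / (q - p))) * K s) p q.
Proof.
  intros Hpq HK; unfold avg, moment.
  assert (H : RInt (fun s => (1 - 2 * th * ((s - (q + p) / 2) / (q - p))) * K s) p q
     = RInt K p q - 2 * th * RInt (fun s => (s - (q + p) / 2) / (q - p) * K s) p q).
  { assert (Hm : ex_RInt (fun s => (s - (q + p) / 2) / (q - p) * K s) p q)
      by (apply ex_RInt_cont; [lra | intros; apply continuous_moment; auto]).
    assert (HK' : ex_RInt K p q) by (apply ex_RInt_cont; [lra | auto]).
    assert (E1 : RInt (fun s => scal (2 * th) ((s - (q + p) / 2) / (q - p) * K s)) p q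
                 = 2 * th * RInt (fun s => (s - (q + p) / 2) / (q - p) * K s) p q)
      by exact (RInt_scal (V := R_CompleteNormedModule) _ _ _ (2 * th) Hm).
    assert (E2 := RInt_minus (V := R_CompleteNormedModule) _ _ _ _ HK'
                    (ex_RInt_scal (V := R_NormedModule) _ _ _ (2 * th) Hm)).
    rewrite <- E1; etransitivity; [|exact E2].
    apply RInt_ext; intros s _; unfold minus, plus, opp, scal; simpl; unfold mult; simpl; ring. }
  rewrite H; field; lra.
Qed.

Lemma avg_moment_ge (p q th : R) (K : R -> R) : p < q -> 0 <= th <= 1 ->
  (forall s, p <= s <= q -> continuous K s) -> (forall s, p <= s <= q -> K p <= K s) ->
  K p <= avg p q K - th * moment p q K.
Proof.
  intros Hpq Hth HK Hmono.
  rewrite avg_moment by assumption.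
  apply Rmult_le_reg_l with (q - p); [lra|].
  rewrite <- Rmult_assoc, Rinv_r, Rmult_1_l by lra.
  (* Antiderivative of the weight times the constant K p, to which K is compared from below. *)
  set (F := fun s => K p * (s - th / (q - p) * (s - (q + p) / 2) ^ 2)).
  replace ((q - p) * K p) with (F q - F p) by (unfold F; field; lra).
  apply RInt_ge_FTC with (fun s => K p * (1 - 2 * th * ((s - (q + p) / 2) / (q - p)))); [lra | | | |].
  - intros s _; unfold F; auto_derive; [exact I | field; lra].
  - intros s _; apply (ex_derive_continuous (fun s => K p * (1 - 2 * th * ((s - (q + p) / 2) / (q - p))))).
    auto_derive; exact I.
  - intros s Hs; apply (continuous_mult (fun s => 1 - 2 * th * ((s - (q + p) / 2) / (q - p))) K);
      [|apply HK, Hs].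
    apply (ex_derive_continuous (fun s => 1 - 2 * th * ((s - (q + p) / 2) / (q - p)))).
    auto_derive; exact I.
  - intros s Hs; rewrite Rmult_comm; apply Rmult_le_compat_l; [|apply Hmono; lra].
    assert (- (/ 2) <= (s - (q + p) / 2) / (q - p) <= / 2) by
      (split; apply Rmult_le_reg_r with (q - p); try lra;
       unfold Rdiv; rewrite (Rmult_assoc _ (/ (q - p))), Rinv_l by lra; lra).
    nra.
Qed.

(** Subtracting the midpoint value of K is free because the weight is odd. The integral of
    [(s - m)^2] over [p, q] is [(q-p)^3/12], and the factor [2/(q-p)^2] turns it into [(q-p)/6]. *)
Lemma moment_le (p q c : R) (K : R -> R) : p < q ->
  (forall s, p <= s <= q -> continuous K s) ->
  (forall s, p <= s <= q ->
     (s - (q + p) / 2) * (K s - K ((q + p) / 2)) <= c * (s - (q + p) / 2) ^ 2) ->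
  moment p q K <= c * ((q - p) / 6).
Proof.
  intros Hpq HK H; unfold moment.
  set (m := (q + p) / 2) in *.
  set (F := fun s => (K m * (s - m) ^ 2 / 2 + c * (s - m) ^ 3 / 3) / (q - p)).
  replace (c * ((q - p) / 6)) with (2 / (q - p) * (F q - F p))
    by (unfold F, m; field; lra).
  apply Rmult_le_compat_l; [left; apply Rdiv_lt_0_compat; lra|].
  apply RInt_le_FTC with (fun s => (K m * (s - m) + c * (s - m) ^ 2) / (q - p)); [lra | | | |].
  - intros s _; unfold F; auto_derive; [exact I | field; lra].
  - intros s _; apply (ex_derive_continuous (fun s => (K m * (s - m) + c * (s - m) ^ 2) / (q - p))).
    auto_derive; exact I.
  - intros s Hs; apply continuous_moment, HK, Hs.
  - intros s Hs.
    replace ((s - m) / (q - p) * K s) with ((s - m) * K s / (q - p)) by (field; lra).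
    apply Rmult_le_compat_r; [left; apply Rinv_0_lt_compat; lra|].
    generalize (H s); lra.
Qed.

(** For increasing K, [s - m] and [K s - K m] have the same sign, m being the midpoint. *)
Lemma moment_ge_0 (p q : R) (K : R -> R) : p < q ->
  (forall s, p <= s <= q -> continuous K s) ->
  (forall s u, p <= s -> s <= u -> u <= q -> K s <= K u) -> 0 <= moment p q K.
Proof.
  intros Hpq HK H; unfold moment.
  set (m := (q + p) / 2) in *.
  set (F := fun s => K m * (s - m) ^ 2 / 2 / (q - p)).
  apply Rmult_le_pos; [left; apply Rdiv_lt_0_compat; lra|].
  replace 0 with (F q - F p) by (unfold F, m; field; lra).
  apply RInt_ge_FTC with (fun s => K m * (s - m) / (q - p)); [lra | | | |].
  - intros s _; unfold F; auto_derive; [exact I | field; lra].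
  - intros s _; apply (ex_derive_continuous (fun s => K m * (s - m) / (q - p))).
    auto_derive; exact I.
  - intros s Hs; apply continuous_moment, HK, Hs.
  - intros s Hs.
    replace ((s - m) / (q - p) * K s) with ((s - m) * K s / (q - p)) by (field; lra).
    apply Rmult_le_compat_r; [left; apply Rinv_0_lt_compat; lra|].
    assert (Hm : p <= m <= q) by (unfold m; lra).
    destruct (Rle_dec s m) as [Hle|Hgt].
    + generalize (H s m); intros; nra.
    + generalize (H m s); intros; nra.
Qed.

Lemma avg_le (p q c : R) (K : R -> R) : p < q ->
  (forall s, p <= s <= q -> continuous K s) ->
  (forall s, p <= s <= q -> K s <= K q - c * (q - s)) ->
  avg p q K <= K q - c * ((q - p) / 2).
Proof.
  intros Hpq HK H; unfold avg.
  set (F := fun s => K q * s + c * (q - s) ^ 2 / 2).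
  replace (K q - c * ((q - p) / 2)) with (/ (q - p) * (F q - F p)) by (unfold F; field; lra).
  apply Rmult_le_compat_l; [left; apply Rinv_0_lt_compat; lra|].
  apply RInt_le_FTC with (fun s => K q - c * (q - s)); [lra | | | |].
  - intros s _; unfold F; auto_derive; [exact I | field; lra].
  - intros s _; apply (ex_derive_continuous (fun s => K q - c * (q - s))).
    auto_derive; exact I.
  - exact HK.
  - intros s Hs; apply H; lra.
Qed.

(** * Increasing convex functions on a half-line s < T, with a possible singularity at T *)

Section Convex.

Context (T : R) (K f : R -> R)
  (HK : forall s, s < T -> is_derive K s (f s))
  (Hf0 : forall s, s < T -> 0 <= f s)
  (Hf : forall s u, s <= u -> u < T -> f s <= f u).

Lemma convex_continuous (s : R) : s < T -> continuous K s.
Proof. intros Hs; apply (ex_derive_continuous K); eexists; apply HK, Hs. Qed.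

Lemma convex_MVT (s u : R) : s <= u -> u < T ->
  exists c, s <= c <= u /\ K u - K s = f c * (u - s).
Proof.
  intros Hsu Hu.
  destruct (MVT_gen K s u f) as [c [Hc E]].
  - intros x Hx; rewrite Rmin_left, Rmax_right in Hx by exact Hsu; apply HK; lra.
  - intros x Hx; rewrite Rmin_left, Rmax_right in Hx by exact Hsu.
    apply continuity_pt_filterlim, convex_continuous; lra.
  - rewrite Rmin_left, Rmax_right in Hc by exact Hsu; exists c; split; assumption.
Qed.

Lemma convex_monotone (s u : R) : s <= u -> u < T -> K s <= K u.
Proof.
  intros Hsu Hu; destruct (convex_MVT s u Hsu Hu) as [c [Hc E]].
  assert (0 <= f c) by (apply Hf0; lra). nra.
Qed.

(** On [p, q] every slope is at least f p, so K lies below the line of that slope through its right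
    endpoint value. *)
Lemma convex_avg_le (p q : R) : p < q -> q < T ->
  avg p q K <= K q - f p * ((q - p) / 2).
Proof.
  intros Hpq Hq; apply avg_le; [exact Hpq | intros; apply convex_continuous; lra|].
  intros s Hs; destruct (convex_MVT s q) as [c [Hc E]]; [lra | lra |].
  assert (f p <= f c) by (apply Hf; lra). nra.
Qed.

(** Difference quotients of K from the midpoint are values of f on [p, q], hence at most f q. *)
Lemma convex_moment_le (p q : R) : p < q -> q < T -> moment p q K <= f q * ((q - p) / 6).
Proof.
  intros Hpq Hq; apply moment_le; [exact Hpq | intros; apply convex_continuous; lra|].
  intros s Hs; set (m := (q + p) / 2).
  assert (Hm : p <= m <= q) by (unfold m; lra).
  destruct (Rle_dec s m) as [Hle|Hgt].
  - destruct (convex_MVT s m) as [c [Hc E]]; [lra | lra |].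
    assert (f c <= f q) by (apply Hf; lra).
    replace ((s - m) * (K s - K m)) with ((K m - K s) * (m - s)) by ring.
    rewrite E, Rmult_assoc; replace ((m - s) * (m - s)) with ((s - m) ^ 2) by ring.
    apply Rmult_le_compat_r; [apply pow2_ge_0 | assumption].
  - destruct (convex_MVT m s) as [c [Hc E]]; [lra | lra |].
    assert (f c <= f q) by (apply Hf; lra).
    rewrite E; replace ((s - m) * (f c * (s - m))) with (f c * (s - m) ^ 2) by ring.
    apply Rmult_le_compat_r; [apply pow2_ge_0 | assumption].
Qed.

Lemma convex_moment_ge_0 (p q : R) : p < q -> q < T -> 0 <= moment p q K.
Proof.
  intros Hpq Hq; apply moment_ge_0; [exact Hpq | intros; apply convex_continuous; lra|].
  intros; apply convex_monotone; lra.
Qed.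

Lemma convex_avg_moment_ge (p q th : R) : p < q -> q < T -> 0 <= th <= 1 ->
  K p <= avg p q K - th * moment p q K.
Proof.
  intros Hpq Hq Hth; apply avg_moment_ge; try assumption.
  - intros; apply convex_continuous; lra.
  - intros; apply convex_monotone; lra.
Qed.

Lemma convex_avg_moment_le (p q c : R) : p < q -> q < T -> 0 <= c ->
  avg p q K - c * moment p q K <= K q.
Proof.
  intros Hpq Hq Hc.
  assert (H1 := convex_avg_le p q Hpq Hq).
  assert (H2 := convex_moment_ge_0 p q Hpq Hq).
  assert (H3 : 0 <= f p) by (apply Hf0; lra).
  nra.
Qed.

(* The constant of the step-ratio restriction comes from here: the average loses at
   least [f p1 * (p2 - p1) / 2] and the preceding moment is at most
   [f p1 * (p1 - p0) / 6]. *)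
Lemma convex_two_steps (p0 p1 p2 c r : R) : p0 < p1 -> p1 < p2 -> p2 < T -> 0 <= c ->
  r = (p2 - p1) / (p1 - p0) -> 1 <= 3 * r ^ 2 * (1 + r) ->
  avg p1 p2 K - c * moment p1 p2 K + moment p0 p1 K / (r * (1 + r)) <= K p2.
Proof.
  intros H01 H12 H2 Hc Hr Hcub.
  assert (Hr0 : 0 < r) by (rewrite Hr; apply Rdiv_lt_0_compat; lra).
  assert (H3 : p2 - p1 = r * (p1 - p0)) by (rewrite Hr; field; lra).
  assert (Ha := convex_avg_le p1 p2 H12 H2).
  assert (Hm1 := convex_moment_ge_0 p1 p2 H12 H2).
  assert (Hm0 := convex_moment_le p0 p1 H01 ltac:(lra)).
  assert (Hfp : 0 <= f p1) by (apply Hf0; lra).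
  assert (Hd : moment p0 p1 K / (r * (1 + r)) <= f p1 * ((p2 - p1) / 2)).
  { apply Rmult_le_reg_r with (r * (1 + r)); [nra|].
    unfold Rdiv at 1; rewrite Rmult_assoc, Rinv_l, Rmult_1_r by nra.
    apply Rle_trans with (1 := Hm0); rewrite H3.
    replace (f p1 * (r * (p1 - p0) / 2) * (r * (1 + r)))
      with (f p1 * ((p1 - p0) / 6) * (3 * r ^ 2 * (1 + r))) by field.
    rewrite <- (Rmult_1_r (f p1 * ((p1 - p0) / 6))) at 1.
    apply Rmult_le_compat_l; [|exact Hcub].
    apply Rmult_le_pos; lra. }
  nra.
Qed.

End Convex.

(** * The convolution kernels *)

Lemma omega_Rpower (al u : R) : omega (1 - al) u = Rpower u (- al) / Gamma (1 - al).
Proof. unfold omega; do 2 f_equal; ring. Qed.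

Lemma is_derive_Rpower_minus (T z s : R) : s < T ->
  is_derive (fun s => Rpower (T - s) z) s (- z * Rpower (T - s) (z - 1)).
Proof.
  intros Hs.
  replace (- z * Rpower (T - s) (z - 1)) with (scal (-1) (z * Rpower (T - s) (z - 1)))
    by (unfold scal; simpl; unfold mult; simpl; ring).
  apply (is_derive_comp (fun u => Rpower u z) (fun s => T - s)).
  - apply is_derive_Rpower; lra.
  - auto_derive; [exact I | ring].
Qed.

Lemma continuous_Rpower_minus (T z s : R) : s < T -> continuous (fun s => Rpower (T - s) z) s.
Proof.
  intros Hs; apply (ex_derive_continuous (fun s => Rpower (T - s) z)).
  eexists; apply is_derive_Rpower_minus, Hs.
Qed.

Lemma Rpower_minus_at_left (T z : R) : 0 < z ->
  filterlim (fun s => Rpower (T - s) z) (at_left T) (locally 0).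
Proof.
  intros Hz; eapply (filterlim_comp _ _ _ (fun s => T - s) (fun u => Rpower u z));
    [|apply Rpower_at_right_0, Hz].
  intros P [d Hd]; exists d; intros s Hs HsT; apply Hd; [|lra].
  unfold ball in *; simpl in *; unfold AbsRing_ball, abs, minus, plus, opp in *; simpl in *.
  apply Rabs_def2 in Hs; apply Rabs_def1; lra.
Qed.

Lemma filter_prod_at_left (a b : R) (P : R * R -> Prop) : a < b ->
  (forall x, a < x < b -> P (a, x)) -> filter_prod (at_point a) (at_left b) P.
Proof.
  intros Hab H; apply (Filter_prod _ _ _ (fun x => x = a) (fun x => a < x < b)).
  - reflexivity.
  - assert (Hd : 0 < b - a) by lra.
    exists (mkposreal _ Hd); intros y Hy Hyb.
    unfold ball in Hy; simpl in Hy; unfold AbsRing_ball, abs, minus, plus, opp in Hy; simpl in Hy.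
    apply Rabs_def2 in Hy; lra.
  - intros x y -> Hy; apply H, Hy.
Qed.

Lemma is_RInt_gen_at_left (F f : R -> R) (a b l : R) : a < b ->
  (forall s, s < b -> is_derive F s (f s)) -> (forall s, s < b -> continuous f s) ->
  filterlim F (at_left b) (locally l) ->
  RInt_gen f (at_point a) (at_left b) = l - F a.
Proof.
  intros Hab HF Hf Hl; apply is_RInt_gen_unique.
  apply (is_RInt_gen_antideriv _ _ F).
  - apply filter_prod_at_left; [exact Hab|]; intros x Hx; simpl.
    apply is_RInt_FTC; [lra | |]; intros; [apply HF | apply Hf]; lra.
  - intros P HP; exact (locally_singleton _ _ HP).
  - exact Hl.
Qed.

(** The kernels are improper integrals for every k. When k < n the endpoint b lies before the
    singularity T, so [RInt f a] is continuous at b and the limit is its value. *)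
Lemma RInt_gen_at_left_RInt (f : R -> R) (a b T : R) : a < b -> b < T ->
  (forall s, s < T -> continuous f s) ->
  RInt_gen f (at_point a) (at_left b) = RInt f a b.
Proof.
  intros Hab HT Hf.
  assert (HF : forall s, s < T -> is_derive (RInt f a) s (f s)).
  { intros s Hs; apply (is_derive_RInt f (RInt f a) a); [|apply Hf, Hs].
    assert (Hd : 0 < T - s) by lra.
    exists (mkposreal _ Hd); intros y Hy.
    unfold ball in Hy; simpl in Hy; unfold AbsRing_ball, abs, minus, plus, opp in Hy; simpl in Hy.
    apply Rabs_def2 in Hy.
    apply (RInt_correct (V := R_CompleteNormedModule)), (ex_RInt_continuous (V := R_CompleteNormedModule)).
    intros z Hz; apply Hf; apply Rle_lt_trans with (1 := proj2 Hz), Rmax_lub_lt; lra. }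
  rewrite (is_RInt_gen_at_left (RInt f a) f a b (RInt f a b) Hab).
  - rewrite RInt_point; unfold zero; simpl; apply Rminus_0_r.
  - intros; apply HF; lra.
  - intros; apply Hf; lra.
  - assert (Hc : continuous (RInt f a) b)
      by (apply (ex_derive_continuous (RInt f a)); eexists; apply HF, HT).
    intros P HP; specialize (Hc P HP); unfold filtermap, at_left, within in *.
    eapply filter_imp; [|exact Hc]; auto.
Qed.

(** The derivative is [b ((T1-s)^(-b-1) - (T2-s)^(-b-1))], which is nonnegative since T1 <= T2.
    Taken with b = al + 1, it yields convexity of the difference of two shifted kernels. *)
Lemma Rpower_minus_diff_monotone (b T1 T2 s u : R) : 0 <= b -> T1 <= T2 -> s <= u -> u < T1 ->
  Rpower (T1 - s) (- b) - Rpower (T2 - s) (- b) <= Rpower (T1 - u) (- b) - Rpower (T2 - u) (- b).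
Proof.
  intros Hb HT Hsu Hu.
  apply (convex_monotone T1 (fun s => Rpower (T1 - s) (- b) - Rpower (T2 - s) (- b))
           (fun s => - - b * Rpower (T1 - s) (- b - 1) - - - b * Rpower (T2 - s) (- b - 1)));
    try assumption.
  - intros x Hx.
    apply (is_derive_minus (fun s => Rpower (T1 - s) (- b)) (fun s => Rpower (T2 - s) (- b)));
      apply is_derive_Rpower_minus; lra.
  - intros x Hx.
    replace (- b - 1) with (- (b + 1)) by ring.
    assert (Rpower (T2 - x) (- (b + 1)) <= Rpower (T1 - x) (- (b + 1)))
      by (apply Rpower_le_antitone; lra).
    nra.
Qed.

Section Kernels.

Context (al : R) (Hal : 0 < al < 1).

Let Gamma_pos_al : 0 < Gamma (1 - al).
Proof. apply Gamma_pos; lra. Qed.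

Lemma is_derive_omega_minus (T s : R) : s < T ->
  is_derive (fun s => omega (1 - al) (T - s)) s
    (al / Gamma (1 - al) * Rpower (T - s) (- (al + 1))).
Proof.
  intros Hs.
  apply is_derive_ext with (fun s => / Gamma (1 - al) * Rpower (T - s) (- al)).
  { intros x; rewrite omega_Rpower; unfold Rdiv; apply Rmult_comm. }
  replace (al / Gamma (1 - al) * Rpower (T - s) (- (al + 1)))
    with (/ Gamma (1 - al) * (- - al * Rpower (T - s) (- al - 1))).
  - apply (is_derive_scal (fun s => Rpower (T - s) (- al))), is_derive_Rpower_minus, Hs.
  - replace (- (al + 1)) with (- al - 1) by ring; field; lra.
Qed.

Lemma continuous_omega_minus (T s : R) : s < T -> continuous (fun s => omega (1 - al) (T - s)) s.
Proof.
  intros Hs; apply (ex_derive_continuous (fun s => omega (1 - al) (T - s))).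
  eexists; apply is_derive_omega_minus, Hs.
Qed.

Let domega (T s : R) : R := al / Gamma (1 - al) * Rpower (T - s) (- (al + 1)).

Lemma domega_ge_0 (T s : R) : s < T -> 0 <= domega T s.
Proof.
  intros _; apply Rmult_le_pos; [left; apply Rdiv_lt_0_compat; lra | left; apply Rpower_pos].
Qed.

Let domega_diff (T1 T2 s : R) : R := domega T1 s - domega T2 s.

Lemma is_derive_omega_diff (T1 T2 s : R) : T1 <= T2 -> s < T1 ->
  is_derive (fun s => omega (1 - al) (T1 - s) - omega (1 - al) (T2 - s)) s (domega_diff T1 T2 s).
Proof.
  intros HT Hs.
  apply (is_derive_minus (fun s => omega (1 - al) (T1 - s)) (fun s => omega (1 - al) (T2 - s)));
    apply is_derive_omega_minus; lra.
Qed.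

Lemma domega_diff_ge_0 (T1 T2 s : R) : T1 <= T2 -> s < T1 -> 0 <= domega_diff T1 T2 s.
Proof.
  intros HT Hs; unfold domega_diff, domega.
  rewrite <- Rmult_minus_distr_l.
  apply Rmult_le_pos; [left; apply Rdiv_lt_0_compat; lra|].
  assert (Rpower (T2 - s) (- (al + 1)) <= Rpower (T1 - s) (- (al + 1)))
    by (apply Rpower_le_antitone; lra).
  lra.
Qed.

Lemma domega_diff_monotone (T1 T2 s u : R) : T1 <= T2 -> s <= u -> u < T1 ->
  domega_diff T1 T2 s <= domega_diff T1 T2 u.
Proof.
  intros HT Hsu Hu; unfold domega_diff, domega.
  rewrite <- !Rmult_minus_distr_l.
  apply Rmult_le_compat_l; [left; apply Rdiv_lt_0_compat; lra|].
  apply Rpower_minus_diff_monotone; lra.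
Qed.

Lemma omega_diff_ge_0 (T1 T2 s : R) : T1 <= T2 -> s < T1 ->
  0 <= omega (1 - al) (T1 - s) - omega (1 - al) (T2 - s).
Proof.
  intros HT Hs; rewrite !omega_Rpower.
  replace (Rpower (T1 - s) (- al) / Gamma (1 - al) - Rpower (T2 - s) (- al) / Gamma (1 - al))
    with ((Rpower (T1 - s) (- al) - Rpower (T2 - s) (- al)) / Gamma (1 - al)) by (field; lra).
  apply Rdiv_le_0_compat; [|assumption].
  assert (Rpower (T2 - s) (- al) <= Rpower (T1 - s) (- al)) by (apply Rpower_le_antitone; lra).
  lra.
Qed.

(* With [u = T - s], [h = T - q], [S = T - p] the weight equals [(2 u - h) / S], and
   [u^(-al) (2 u - h)] is at most the derivative in [u] of
   [u (u - h) u^(-al) + al (q - p) / (S (2 - al)) u^2 u^(-al)]. *)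
Lemma omega_avg_moment_le (T p q : R) : p < q -> q < T ->
  avg p q (fun s => omega (1 - al) (T - s))
    - (q - p) / (T - p) * moment p q (fun s => omega (1 - al) (T - s))
  <= (1 + al / (2 - al)) * (Rpower (T - p) (- al) / Gamma (1 - al)).
Proof.
  intros Hpq HT; set (G := Gamma (1 - al)) in *.
  rewrite avg_moment by (assumption || intros; apply continuous_omega_minus; lra).
  set (S := T - p). set (h := T - q).
  assert (HS : 0 < S) by (unfold S; lra). assert (Hh : 0 < h) by (unfold h; lra).
  set (c := al * (q - p) / (S * (2 - al))).
  assert (Hc : 0 <= c) by (unfold c; apply Rdiv_le_0_compat; nra).
  set (F := fun s => - ((T - s) * (T - s - h) + c * (T - s) ^ 2) / (S * G) * Rpower (T - s) (- al)).
  assert (Hlt : forall s, s <= q -> s < T) by (intros; lra).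
  apply Rmult_le_reg_l with (q - p); [lra|].
  rewrite <- Rmult_assoc, Rinv_r, Rmult_1_l by lra.
  apply Rle_trans with (F q - F p).
  - apply RInt_le_FTC with (fun s => (2 * (T - s) - h + al * (q - p) / S * (T - s) - al * (T - s - h))
        / (S * G) * Rpower (T - s) (- al)); [lra | | | |].
    + intros s Hs; unfold F.
      replace ((2 * (T - s) - h + al * (q - p) / S * (T - s) - al * (T - s - h))
        / (S * G) * Rpower (T - s) (- al)) with
        ((2 * (T - s) - h + 2 * c * (T - s)) / (S * G) * Rpower (T - s) (- al)
         + - ((T - s) * (T - s - h) + c * (T - s) ^ 2) / (S * G) * (- - al * Rpower (T - s) (- al - 1))).
      * apply (is_derive_mult (fun s => - ((T - s) * (T - s - h) + c * (T - s) ^ 2) / (S * G))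
                 (fun s => Rpower (T - s) (- al)));
          [| apply is_derive_Rpower_minus, Hlt, Hs | intros; apply Rmult_comm].
        auto_derive; [exact I | field; split; lra].
      * rewrite (Rpower_succ (T - s) (- al)) by (generalize (Hlt s); lra).
        unfold c; field; repeat split; lra.
    + intros s Hs.
      apply (continuous_mult (fun s => (2 * (T - s) - h + al * (q - p) / S * (T - s) - al * (T - s - h))
        / (S * G)) (fun s => Rpower (T - s) (- al))).
      * apply (ex_derive_continuous (fun s => (2 * (T - s) - h + al * (q - p) / S * (T - s) - al * (T - s - h))
          / (S * G))); auto_derive; exact I.
      * apply continuous_Rpower_minus, Hlt, Hs.
    + intros s Hs.
      apply (continuous_mult (fun s => 1 - 2 * ((q - p) / S) * ((s - (q + p) / 2) / (q - p)))
               (fun s => omega (1 - al) (T - s))).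
      * apply (ex_derive_continuous (fun s => 1 - 2 * ((q - p) / S) * ((s - (q + p) / 2) / (q - p)))).
        auto_derive; exact I.
      * apply continuous_omega_minus, Hlt, Hs.
    + intros s Hs; rewrite omega_Rpower; fold G.
      replace ((1 - 2 * ((q - p) / S) * ((s - (q + p) / 2) / (q - p))) * (Rpower (T - s) (- al) / G))
        with ((2 * (T - s) - h) / (S * G) * Rpower (T - s) (- al))
        by (unfold S, h in *; field; repeat split; lra).
      apply Rmult_le_compat_r; [left; apply Rpower_pos|].
      apply Rmult_le_compat_r; [left; apply Rinv_0_lt_compat, Rmult_lt_0_compat; assumption|].
      assert (H : al * (T - s - h) <= al * (q - p) / S * (T - s)); [|lra].
      apply Rmult_le_reg_r with S; [exact HS|].
      replace (al * (q - p) / S * (T - s) * S) with (al * ((q - p) * (T - s))) by (field; lra).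
      rewrite Rmult_assoc; apply Rmult_le_compat_l; [lra|].
      unfold h, S; nra.
  - assert (HFq : F q <= 0).
    { unfold F, h; rewrite Rminus_diag, Rmult_0_r, Rplus_0_l.
      apply Rmult_le_0_r; [|left; apply Rpower_pos].
      apply Rmult_le_0_r; [|left; apply Rinv_0_lt_compat, Rmult_lt_0_compat; assumption].
      assert (0 <= c * (T - q) ^ 2) by (apply Rmult_le_pos; [exact Hc | apply pow2_ge_0]); lra. }
    assert (HFp : - F p = (q - p) * ((1 + al / (2 - al)) * (Rpower S (- al) / G))).
    { unfold F; fold S; unfold c; replace (S - h) with (q - p) by (unfold S, h; ring).
      field; repeat split; lra. }
    lra.
Qed.

(** * Kernel entries on the time grid and their comparison between levels *)

Context (t : nat -> R) (Ht : forall k, t k < t (S k)).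

Lemma time_lt (i j : nat) : (i < j)%nat -> t i < t j.
Proof.
  induction 1 as [|j Hj IH]; [apply Ht|].
  apply Rlt_trans with (t j); [exact IH | apply Ht].
Qed.

Lemma time_le (i j : nat) : (i <= j)%nat -> t i <= t j.
Proof.
  intros Hij; destruct (Nat.eq_dec i j) as [->|Hne]; [lra|].
  left; apply time_lt; lia.
Qed.

Lemma tau_pos (k : nat) : (1 <= k)%nat -> 0 < tau t k.
Proof. intros Hk; unfold tau; assert (t (k - 1)%nat < t k) by (apply time_lt; lia); lra. Qed.

Lemma ratio_eq (k : nat) : (2 <= k)%nat -> ratio t k = tau t k / tau t (k - 1).
Proof. intros Hk; destruct k as [|[|k]]; [lia | lia | reflexivity]. Qed.

Lemma ratio_pos (k : nat) : (2 <= k)%nat -> 0 < ratio t k.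
Proof.
  intros Hk; rewrite ratio_eq by exact Hk; apply Rdiv_lt_0_compat; apply tau_pos; lia.
Qed.

Let om (n : nat) (s : R) : R := omega (1 - al) (t n - s).

Lemma akern_lt (n k : nat) : (1 <= k < n)%nat ->
  akern al t n k = avg (t (k - 1)%nat) (t k) (om n).
Proof.
  intros Hk; unfold akern, avg, tau.
  rewrite (RInt_gen_at_left_RInt (om n) _ _ (t n)); [reflexivity | apply time_lt; lia.. |].
  apply continuous_omega_minus.
Qed.

Lemma etakern_lt (n k : nat) : (1 <= k < n)%nat ->
  etakern al t n k = moment (t (k - 1)%nat) (t k) (om n).
Proof.
  intros Hk; unfold etakern, moment, tau.
  rewrite (RInt_gen_at_left_RInt
    (fun s => (s - (t k + t (k - 1)%nat) / 2) / (t k - t (k - 1)%nat) * omega (1 - al) (t n - s))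
     _ _ (t n)); [reflexivity | apply time_lt; lia.. |].
  intros s Hs; apply continuous_moment, continuous_omega_minus, Hs.
Qed.

Lemma akern_diag (n : nat) : (1 <= n)%nat ->
  akern al t n n = Rpower (tau t n) (- al) / ((1 - al) * Gamma (1 - al)).
Proof.
  intros Hn; assert (Htau := tau_pos n Hn); unfold akern.
  set (c := / ((1 - al) * Gamma (1 - al))).
  rewrite (is_RInt_gen_at_left (fun s => - c * Rpower (t n - s) (1 - al))
             (fun s => omega (1 - al) (t n - s)) _ _ (- c * 0)).
  - fold (tau t n); rewrite (Rpower_succ _ (1 - al)) by exact Htau.
    replace (1 - al - 1) with (- al) by ring; unfold c; field; repeat split; lra.
  - apply time_lt; lia.
  - intros s Hs; rewrite omega_Rpower.
    replace (Rpower (t n - s) (- al) / Gamma (1 - al))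
      with (- c * (- (1 - al) * Rpower (t n - s) (1 - al - 1)))
      by (replace (1 - al - 1) with (- al) by ring; unfold c; field; split; lra).
    apply (is_derive_scal (fun s => Rpower (t n - s) (1 - al))), is_derive_Rpower_minus, Hs.
  - intros; apply continuous_omega_minus; assumption.
  - eapply filterlim_comp; [apply Rpower_minus_at_left; lra | apply (filterlim_scal_r (- c) 0)].
Qed.

Lemma etakern_diag (n : nat) : (1 <= n)%nat ->
  etakern al t n n = al / (2 - al) * akern al t n n.
Proof.
  intros Hn; rewrite (akern_diag n Hn); assert (Htau := tau_pos n Hn); unfold etakern.
  (* Since [s - t_(n-1/2) = tau_n/2 - (t_n - s)], the integrand combines the powers -al and 1 - al
     of [t_n - s]; c1 and c2 are the coefficients of the resulting antiderivative. *)
  set (c1 := / (2 * (1 - al) * Gamma (1 - al))).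
  set (c2 := / ((2 - al) * tau t n * Gamma (1 - al))).
  rewrite (is_RInt_gen_at_left
             (fun s => - c1 * Rpower (t n - s) (1 - al) + c2 * Rpower (t n - s) (2 - al))
             (fun s => (s - (t n + t (n - 1)%nat) / 2) / tau t n * omega (1 - al) (t n - s))
             _ _ (- c1 * 0 + c2 * 0)).
  - fold (tau t n); rewrite (Rpower_succ _ (2 - al)), (Rpower_succ _ (2 - al - 1)),
      (Rpower_succ _ (1 - al)) by exact Htau.
    replace (2 - al - 1 - 1) with (- al) by ring.
    replace (1 - al - 1) with (- al) by ring; unfold c1, c2; field; repeat split; lra.
  - apply time_lt; lia.
  - intros s Hs; rewrite omega_Rpower.
    replace ((s - (t n + t (n - 1)%nat) / 2) / tau t n * (Rpower (t n - s) (- al) / Gamma (1 - al)))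
      with (- c1 * (- (1 - al) * Rpower (t n - s) (1 - al - 1))
            + c2 * (- (2 - al) * Rpower (t n - s) (2 - al - 1))).
    + apply (is_derive_plus (fun s => - c1 * Rpower (t n - s) (1 - al))
               (fun s => c2 * Rpower (t n - s) (2 - al)));
        [apply (is_derive_scal (fun s => Rpower (t n - s) (1 - al)))
        |apply (is_derive_scal (fun s => Rpower (t n - s) (2 - al)))];
        apply is_derive_Rpower_minus, Hs.
    + rewrite (Rpower_succ _ (2 - al - 1)) by lra.
      replace (2 - al - 1 - 1) with (- al) by ring.
      replace (1 - al - 1) with (- al) by ring.
      unfold c1, c2, tau in *; field; repeat split; lra.
  - intros s Hs; apply (continuous_moment (t (n - 1)%nat) (t n)), continuous_omega_minus, Hs.
  - apply (filterlim_comp_2 (G := locally (- c1 * 0)) (H := locally (c2 * 0))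
      (fun s => - c1 * Rpower (t n - s) (1 - al)) (fun s => c2 * Rpower (t n - s) (2 - al)) Rplus).
    + eapply filterlim_comp; [apply Rpower_minus_at_left; lra | apply (filterlim_scal_r (- c1) 0)].
    + eapply filterlim_comp; [apply Rpower_minus_at_left; lra | apply (filterlim_scal_r c2 0)].
    + apply (filterlim_plus (- c1 * 0) (c2 * 0)).
Qed.

Lemma etakern_ge_0 (n k : nat) : (1 <= k < n)%nat -> 0 <= etakern al t n k.
Proof.
  intros Hk; rewrite etakern_lt by exact Hk.
  apply (convex_moment_ge_0 (t n) (om n) (domega (t n))).
  - apply is_derive_omega_minus.
  - apply domega_ge_0.
  - apply time_lt; lia.
  - apply time_lt; lia.
Qed.

Lemma akern_diag_pos (n : nat) : (1 <= n)%nat -> 0 < akern al t n n.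
Proof.
  intros Hn; rewrite akern_diag by exact Hn.
  apply Rdiv_lt_0_compat; [apply Rpower_pos | apply Rmult_lt_0_compat; lra].
Qed.

(** The contribution of the preceding step to [hatakern]; the value 0 at k = 1 lets the first entry
    share the formula of the others. *)
Definition etaprev (n k : nat) : R :=
  if (k =? 1)%nat then 0 else etakern al t n (k - 1) / (ratio t k * (1 + ratio t k)).

Lemma hatakern_lt (n k : nat) : (1 <= k < n)%nat ->
  hatakern al t n k
  = akern al t n k - etakern al t n k / (1 + ratio t (k + 1)) + etaprev n k.
Proof.
  intros Hk; unfold hatakern, etaprev.
  destruct (Nat.eqb_spec n 1); [lia|]; destruct (Nat.eqb_spec k n); [lia|].
  destruct (Nat.eqb_spec k 1) as [->|]; [apply eq_sym, Rplus_0_r | reflexivity].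
Qed.

Lemma hatakern_diag (n : nat) : (2 <= n)%nat ->
  hatakern al t n n = (1 - al) / (2 - al) * akern al t n n + etaprev n n.
Proof.
  intros Hn; unfold hatakern, etaprev.
  destruct (Nat.eqb_spec n 1); [lia|]; rewrite Nat.eqb_refl; reflexivity.
Qed.

Lemma Akern_lt (n k : nat) : (k < n)%nat -> Akern al t n k = hatakern al t n k.
Proof. intros Hk; unfold Akern; destruct (Nat.eqb_spec k n); [lia | reflexivity]. Qed.

Lemma Akern_diag (n : nat) : Akern al t n n = 2 * hatakern al t n n.
Proof. unfold Akern; rewrite Nat.eqb_refl; reflexivity. Qed.

Let omdiff (n : nat) (s : R) : R := om (n - 1) s - om n s.

Lemma akern_decay (n k : nat) : (1 <= k < n - 1)%nat ->
  akern al t (n - 1) k - akern al t n k = avg (t (k - 1)%nat) (t k) (omdiff n).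
Proof.
  intros Hk; rewrite !akern_lt by lia; symmetry; apply avg_minus.
  - apply time_lt; lia.
  - intros; apply continuous_omega_minus; apply Rle_lt_trans with (t k); [lra | apply time_lt; lia].
  - intros; apply continuous_omega_minus; apply Rle_lt_trans with (t k); [lra | apply time_lt; lia].
Qed.

Lemma etakern_decay (n k : nat) : (1 <= k < n - 1)%nat ->
  etakern al t (n - 1) k - etakern al t n k = moment (t (k - 1)%nat) (t k) (omdiff n).
Proof.
  intros Hk; rewrite !etakern_lt by lia; symmetry; apply moment_minus.
  - apply time_lt; lia.
  - intros; apply continuous_omega_minus; apply Rle_lt_trans with (t k); [lra | apply time_lt; lia].
  - intros; apply continuous_omega_minus; apply Rle_lt_trans with (t k); [lra | apply time_lt; lia].
Qed.

(** Lower half of the separation by grid values; it is used with [th = 1/(1 + r_(k+1))], the weight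
    of the moment in [hatakern]. *)
Lemma decay_at_left_end (n k : nat) (th : R) : (1 <= k < n - 1)%nat -> 0 <= th <= 1 ->
  omdiff n (t (k - 1)%nat) <= (akern al t (n - 1) k - akern al t n k)
     - th * (etakern al t (n - 1) k - etakern al t n k).
Proof.
  intros Hk Hth; rewrite akern_decay, etakern_decay by exact Hk.
  assert (HT : t (n - 1)%nat <= t n) by (apply time_le; lia).
  apply (convex_avg_moment_ge (t (n - 1)%nat) (omdiff n) (domega_diff (t (n - 1)%nat) (t n)));
    [| | apply time_lt; lia | apply time_lt; lia | exact Hth].
  - intros s Hs; apply is_derive_omega_diff; assumption.
  - intros s Hs; apply domega_diff_ge_0; assumption.
Qed.

Lemma omdiff_ge_0 (n k : nat) : (k < n - 1)%nat -> 0 <= omdiff n (t k).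
Proof. intros Hk; apply omega_diff_ge_0; [apply time_le | apply time_lt]; lia. Qed.

Context (Hr : forall k, (2 <= k)%nat -> Rstar <= ratio t k).

Lemma decay_at_right_end (n k : nat) : (1 <= k < n - 1)%nat ->
  (akern al t (n - 1) k - akern al t n k)
    - (etakern al t (n - 1) k - etakern al t n k) / ratio t (k + 1)
    + (etaprev (n - 1) k - etaprev n k) <= omdiff n (t k).
Proof.
  intros Hk; rewrite akern_decay, etakern_decay by exact Hk.
  assert (HT : t (n - 1)%nat <= t n) by (apply time_le; lia).
  assert (Hr1 : 0 < ratio t (k + 1)) by (apply ratio_pos; lia).
  assert (Hd : forall s, s < t (n - 1)%nat -> is_derive (omdiff n) s (domega_diff (t (n - 1)%nat) (t n) s))
    by (intros; apply is_derive_omega_diff; assumption).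
  assert (Hd0 : forall s, s < t (n - 1)%nat -> 0 <= domega_diff (t (n - 1)%nat) (t n) s)
    by (intros; apply domega_diff_ge_0; assumption).
  assert (Hdm : forall s u, s <= u -> u < t (n - 1)%nat ->
     domega_diff (t (n - 1)%nat) (t n) s <= domega_diff (t (n - 1)%nat) (t n) u)
    by (intros; apply domega_diff_monotone; assumption).
  unfold etaprev; destruct (Nat.eqb_spec k 1) as [->|Hne].
  - assert (H := convex_avg_moment_le _ _ _ Hd Hd0 Hdm (t (1 - 1)%nat) (t 1%nat)
       (/ ratio t (1 + 1)) ltac:(apply time_lt; lia) ltac:(apply time_lt; lia)
       ltac:(left; apply Rinv_0_lt_compat; exact Hr1)).
    unfold Rdiv; lra.
  - destruct (Rstar_le_cubic _ (Hr k ltac:(lia))) as [Hr0 Hcub].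
    assert (H := convex_two_steps _ _ _ Hd Hd0 Hdm (t (k - 1 - 1)%nat) (t (k - 1)%nat) (t k)
       (/ ratio t (k + 1)) (ratio t k) ltac:(apply time_lt; lia) ltac:(apply time_lt; lia)
       ltac:(apply time_lt; lia) ltac:(left; apply Rinv_0_lt_compat; exact Hr1)
       ltac:(apply ratio_eq; lia) Hcub).
    rewrite <- (etakern_decay n (k - 1)) in H by lia.
    unfold Rdiv in *; lra.
Qed.

(** Here [1/(1 + r_n) = tau_(n-1)/(tau_(n-1) + tau_n)], which is exactly the weight [(q-p)/(T-p)] of
    [omega_avg_moment_le] for p = t_(n-2), q = t_(n-1), T = t_n. *)
Lemma akern_etakern_prev_le (n : nat) : (2 <= n)%nat ->
  akern al t n (n - 1) - etakern al t n (n - 1) / (1 + ratio t n)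
  <= (1 + al / (2 - al)) * om n (t (n - 2)%nat).
Proof.
  intros Hn; rewrite akern_lt, etakern_lt by lia.
  assert (H := omega_avg_moment_le (t n) (t (n - 1 - 1)%nat) (t (n - 1)%nat)
                 ltac:(apply time_lt; lia) ltac:(apply time_lt; lia)).
  assert (H1 : 0 < tau t (n - 1)) by (apply tau_pos; lia).
  assert (H2 : 0 < tau t n) by (apply tau_pos; lia).
  replace (moment (t (n - 1 - 1)%nat) (t (n - 1)%nat) (om n) / (1 + ratio t n))
    with ((t (n - 1)%nat - t (n - 1 - 1)%nat) / (t n - t (n - 1 - 1)%nat)
          * moment (t (n - 1 - 1)%nat) (t (n - 1)%nat) (om n)).
  - replace (n - 2)%nat with (n - 1 - 1)%nat by lia.
    unfold om at 3; rewrite omega_Rpower; exact H.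
  - rewrite ratio_eq by exact Hn; unfold tau in *; field; lra.
Qed.

Lemma akern_diag_om (n : nat) : (1 <= n)%nat ->
  (1 - al) * akern al t n n = om n (t (n - 1)%nat).
Proof.
  intros Hn; rewrite akern_diag by exact Hn; unfold om; rewrite omega_Rpower.
  fold (tau t n); field; lra.
Qed.

Lemma Akern_first_decay (n : nat) : (2 <= n)%nat -> Akern al t n 1 <= Akern al t (n - 1) 1.
Proof.
  intros Hn; rewrite Akern_lt, hatakern_lt by lia; unfold etaprev; simpl (1 =? 1)%nat; cbv iota.
  assert (Hr2 : 0 < ratio t (1 + 1)) by (apply ratio_pos; lia).
  assert (Hth : 0 <= / (1 + ratio t (1 + 1)) <= 1).
  { split; [left; apply Rinv_0_lt_compat; lra|].
    rewrite <- Rinv_1; apply Rinv_le_contravar; lra. }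
  destruct (Nat.eq_dec n 2) as [->|Hne].
  (* Level 1 has [hatakern = akern], without the factor [(1-al)/(2-al)]. So A_0 is [2 a_0], and
     [1 + al/(2-al) <= 2] suffices. *)
  - simpl (2 - 1)%nat; rewrite Akern_diag.
    change (hatakern al t 1 1) with (akern al t 1 1).
    assert (H1 := akern_etakern_prev_le 2 ltac:(lia)); simpl Nat.sub in H1.
    assert (H2 := akern_diag_om 1 ltac:(lia)); simpl Nat.sub in H2.
    assert (H3 := omdiff_ge_0 2 0 ltac:(lia)); unfold omdiff in H3; simpl Nat.sub in H3.
    assert (H4 := akern_diag_pos 1 ltac:(lia)).
    simpl (1 + 1)%nat.
    assert (H5 : (1 + al / (2 - al)) * om 2 (t 0%nat) <= 2 * ((1 - al) * akern al t 1 1)).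
    { rewrite H2; apply Rle_trans with (2 * om 2 (t 0%nat)); [|lra].
      apply Rmult_le_compat_r.
      - unfold om; rewrite omega_Rpower; left; apply Rdiv_lt_0_compat; [apply Rpower_pos | assumption].
      - assert (al / (2 - al) <= 1); [|lra].
        apply Rmult_le_reg_r with (2 - al); [lra|]; unfold Rdiv; rewrite Rmult_assoc, Rinv_l; lra. }
    nra.
  - rewrite Akern_lt, hatakern_lt by lia; unfold etaprev; simpl (1 =? 1)%nat; cbv iota.
    assert (H1 := decay_at_left_end n 1 _ ltac:(lia) Hth).
    assert (H2 := omdiff_ge_0 n (1 - 1) ltac:(lia)).
    unfold Rdiv; lra.
Qed.

(** Both sides are compared with [omdiff n (t j)]; [Hpf] is the partial fraction that collects the
    moment over step j. *)
Lemma Akern_increment_decay (n j : nat) : (1 <= j <= n - 2)%nat ->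
  Akern al t n (j + 1) - Akern al t n j <= Akern al t (n - 1) (j + 1) - Akern al t (n - 1) j.
Proof.
  intros Hj.
  assert (Hright := decay_at_right_end n j ltac:(lia)).
  assert (Hr1 : 0 < ratio t (j + 1)) by (apply ratio_pos; lia).
  assert (Hr2 : 0 < ratio t (j + 1 + 1)) by (apply ratio_pos; lia).
  assert (Hpf : forall e, e / (1 + ratio t (j + 1)) + e / (ratio t (j + 1) * (1 + ratio t (j + 1)))
                = e / ratio t (j + 1)) by (intros; field; lra).
  assert (He : forall m, etaprev m (j + 1)
                 = etakern al t m j / (ratio t (j + 1) * (1 + ratio t (j + 1)))).
  { intros m; unfold etaprev; destruct (Nat.eqb_spec (j + 1) 1); [lia|].
    replace (j + 1 - 1)%nat with j by lia; reflexivity. }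
  assert (P1 := Hpf (etakern al t (n - 1) j)). assert (P2 := Hpf (etakern al t n j)).
  rewrite (Akern_lt n (j + 1)), (Akern_lt n j), (Akern_lt (n - 1) j) by lia.
  rewrite (hatakern_lt n (j + 1)), (hatakern_lt n j), (hatakern_lt (n - 1) j) by lia.
  destruct (Nat.eq_dec (j + 1) (n - 1)) as [Hjn|Hne].
  (* Diagonal case. Doubling A_0 also doubles its [etaprev] term; one copy is needed for the balance
     and the other is nonnegative surplus ([H4]). *)
  - assert (H1 := akern_etakern_prev_le n ltac:(lia)).
    assert (H2 := akern_diag_om (n - 1) ltac:(lia)).
    assert (H3 := omdiff_ge_0 n j ltac:(lia)).
    assert (H4 : 0 <= etakern al t (n - 1) j / (ratio t (j + 1) * (1 + ratio t (j + 1)))).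
    { apply Rdiv_le_0_compat; [apply etakern_ge_0; lia | apply Rmult_lt_0_compat; lra]. }
    assert (Hn : n = S (S j)) by lia.
    unfold omdiff in *.
    replace (n - 1 - 1)%nat with j in * by lia.
    replace (n - 2)%nat with j in * by lia.
    replace (n - 1)%nat with (j + 1)%nat in * by lia.
    replace (j + 1 + 1)%nat with n in * by lia.
    rewrite Akern_diag, hatakern_diag, !He by lia.
    assert (H5 : 2 * ((1 - al) / (2 - al) * akern al t (j + 1) (j + 1))
                 = (1 + al / (2 - al)) * om (j + 1) (t j)).
    { rewrite <- H2; field; lra. }
    assert (H7 : 0 <= al / (2 - al)) by (apply Rdiv_le_0_compat; lra).
    unfold Rdiv in *; nra.
  - rewrite (Akern_lt (n - 1) (j + 1)), (hatakern_lt (n - 1) (j + 1)) by lia.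
    rewrite !He.
    assert (Hth : 0 <= / (1 + ratio t (j + 1 + 1)) <= 1).
    { split; [left; apply Rinv_0_lt_compat; lra|].
      rewrite <- Rinv_1; apply Rinv_le_contravar; lra. }
    assert (Hleft := decay_at_left_end n (j + 1) _ ltac:(lia) Hth).
    replace (j + 1 - 1)%nat with j in Hleft by lia.
    unfold Rdiv in *; lra.
Qed.

End Kernels.

(** * The discrete convolution as a quadratic form *)

Lemma sum_n_m_le_loc (a b : nat -> R) (n m : nat) :
  (forall k, (n <= k <= m)%nat -> a k <= b k) -> sum_n_m a n m <= sum_n_m b n m.
Proof.
  intros H; destruct (Nat.lt_ge_cases m n) as [Hlt|Hge].
  { rewrite !sum_n_m_zero by exact Hlt; apply Rle_refl. }
  induction Hge as [|m Hge IH].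
  - rewrite !sum_n_n; apply H; lia.
  - rewrite !sum_n_Sm by lia; apply Rplus_le_compat.
    + apply IH; intros k Hk; apply H; lia.
    + apply H; lia.
Qed.

Lemma sum_n_m_Rplus (a b : nat -> R) (n m : nat) :
  sum_n_m (fun k => a k + b k) n m = sum_n_m a n m + sum_n_m b n m :> R.
Proof. exact (sum_n_m_plus a b n m). Qed.

Lemma sum_n_m_Rmult_l (c : R) (a : nat -> R) (n m : nat) :
  sum_n_m (fun k => c * a k) n m = c * sum_n_m a n m :> R.
Proof. exact (sum_n_m_mult_l (K := R_Ring) c a n m). Qed.

Lemma sum_n_m_Rsucc (a : nat -> R) (n m : nat) : (n <= S m)%nat ->
  sum_n_m a n (S m) = sum_n_m a n m + a (S m) :> R.
Proof. exact (sum_n_Sm a n m). Qed.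

Lemma sum_n_m_Rzero (a : nat -> R) (n m : nat) : (m < n)%nat -> sum_n_m a n m = 0 :> R.
Proof. exact (sum_n_m_zero a n m). Qed.

Lemma sum_n_m_Rext (a b : nat -> R) (n m : nat) :
  (forall k, (n <= k <= m)%nat -> a k = b k) -> sum_n_m a n m = sum_n_m b n m :> R.
Proof. exact (sum_n_m_ext_loc a b n m). Qed.

Lemma sum_n_m_telescope (A : nat -> R) (m : nat) :
  sum_n_m (fun j => A (j + 1)%nat - A j) 1 m + A 1%nat = A (m + 1)%nat.
Proof.
  induction m as [|m IH].
  - rewrite sum_n_m_zero by lia; apply Rplus_0_l.
  - rewrite sum_n_m_Rsucc by lia.
    replace (m + 1)%nat with (S m) in * by lia; lra.
Qed.

(** Summation by parts onto the tail sums of v, the quantities whose squares appear in the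
    energy. *)
Lemma sum_n_m_Abel (A v : nat -> R) (m : nat) :
  sum_n_m (fun k => A k * v k) 1 (S m)
  = sum_n_m (fun j => (A (j + 1)%nat - A j) * sum_n_m v (j + 1) (S m)) 1 m
    + A 1%nat * sum_n_m v 1 (S m) :> R.
Proof.
  induction m as [|m IH].
  - rewrite !sum_n_n, sum_n_m_zero by lia; symmetry; apply Rplus_0_l.
  - rewrite sum_n_m_Rsucc, IH by lia.
    rewrite (sum_n_m_Rext (fun j => (A (j + 1)%nat - A j) * sum_n_m v (j + 1) (S (S m)))
      (fun j => (A (j + 1)%nat - A j) * sum_n_m v (j + 1) (S m)
                + v (S (S m)) * (A (j + 1)%nat - A j))).
    + rewrite sum_n_m_Rplus, sum_n_m_Rmult_l.
      rewrite (sum_n_m_Rsucc (fun j => (A (j + 1)%nat - A j) * sum_n_m v (j + 1) (S m))) by lia.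
      rewrite (sum_n_m_Rzero v (S m + 1) (S m)), (sum_n_m_Rsucc v 1 (S m)) by lia.
      assert (HT := sum_n_m_telescope A (S m)).
      replace (S m + 1)%nat with (S (S m)) in * by lia.
      replace (sum_n_m (fun j => A (j + 1)%nat - A j) 1 (S m)) with (A (S (S m)) - A 1%nat) by lra.
      ring.
    + intros k Hk; rewrite sum_n_m_Rsucc by lia; ring.
Qed.

Definition conv_form (A v : nat -> R) (n : nat) : R :=
  sum_n_m (fun j => (A (j + 1)%nat - A j) * sum_n_m v (j + 1) n ^ 2) 1 (n - 1)
  + A 1%nat * sum_n_m v 1 n ^ 2.

(** Each tail sum S of level n is the one of level n-1 plus w = v n, and
    [w S = (S^2 - (S-w)^2 + w^2)/2]. The weights of the [w^2] terms telescope to A n. The level n-1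
    squares carry weights from A, which the hypotheses replace by those from B. *)
Lemma conv_form_decay (A B v : nat -> R) (n : nat) : (2 <= n)%nat ->
  A 1%nat <= B 1%nat ->
  (forall j, (1 <= j <= n - 2)%nat -> A (j + 1)%nat - A j <= B (j + 1)%nat - B j) ->
  / 2 * conv_form A v n - / 2 * conv_form B v (n - 1) + / 2 * A n * v n ^ 2
  <= v n * sum_n_m (fun k => A k * v k) 1 n.
Proof.
  intros Hn H1 HAB.
  destruct n as [|[|m]]; [lia | lia |].
  unfold conv_form; rewrite sum_n_m_Abel.
  replace (S (S m) - 1)%nat with (S m) by lia; replace (S m - 1)%nat with m by lia.
  set (w := v (S (S m))).
  assert (HS : forall j, (j <= S m)%nat ->
            sum_n_m v (j + 1) (S (S m)) = sum_n_m v (j + 1) (S m) + w :> R)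
    by (intros; rewrite sum_n_m_Rsucc by lia; reflexivity).
  assert (E : w * sum_n_m (fun j => (A (j + 1)%nat - A j) * sum_n_m v (j + 1) (S (S m))) 1 (S m)
    = / 2 * sum_n_m (fun j => (A (j + 1)%nat - A j) * sum_n_m v (j + 1) (S (S m)) ^ 2) 1 (S m)
      - / 2 * sum_n_m (fun j => (A (j + 1)%nat - A j) * sum_n_m v (j + 1) (S m) ^ 2) 1 m
      + / 2 * w ^ 2 * (A (S (S m)) - A 1%nat)).
  { replace (A (S (S m)) - A 1%nat) with (sum_n_m (fun j => A (j + 1)%nat - A j) 1 (S m))
      by (generalize (sum_n_m_telescope A (S m)); replace (S m + 1)%nat with (S (S m)) by lia; lra).
    (* At j = m + 1 the tail sum of the earlier level is empty, so both sums may run over the same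
       range. *)
    assert (Hz : sum_n_m (fun j => (A (j + 1)%nat - A j) * sum_n_m v (j + 1) (S m) ^ 2) 1 m
        = sum_n_m (fun j => (A (j + 1)%nat - A j) * sum_n_m v (j + 1) (S m) ^ 2) 1 (S m) :> R).
    { rewrite (sum_n_m_Rsucc _ 1 m), (sum_n_m_Rzero v (S m + 1) (S m)) by lia.
      symmetry; ring. }
    rewrite Hz.
    transitivity (sum_n_m (fun j =>
        / 2 * ((A (j + 1)%nat - A j) * sum_n_m v (j + 1) (S (S m)) ^ 2)
        + (- / 2 * ((A (j + 1)%nat - A j) * sum_n_m v (j + 1) (S m) ^ 2)
           + / 2 * w ^ 2 * (A (j + 1)%nat - A j))) 1 (S m)).
    - rewrite <- sum_n_m_Rmult_l; apply sum_n_m_Rext; intros j Hj; rewrite HS by lia; field.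
    - rewrite !sum_n_m_Rplus, !sum_n_m_Rmult_l; ring. }
  rewrite (Rmult_plus_distr_l w), E.
  rewrite (HS 0%nat : _ -> sum_n_m v 1 (S (S m)) = sum_n_m v 1 (S m) + w :> R) by lia.
  assert (Hle : sum_n_m (fun j => (A (j + 1)%nat - A j) * sum_n_m v (j + 1) (S m) ^ 2) 1 m
             <= sum_n_m (fun j => (B (j + 1)%nat - B j) * sum_n_m v (j + 1) (S m) ^ 2) 1 m).
  { apply sum_n_m_le_loc; intros j Hj; apply Rmult_le_compat_r; [apply pow2_ge_0|].
    apply HAB; lia. }
  assert (H0 : A 1%nat * sum_n_m v 1 (S m) ^ 2 <= B 1%nat * sum_n_m v 1 (S m) ^ 2)
    by (apply Rmult_le_compat_r; [apply pow2_ge_0 | exact H1]).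
  set (s0 := sum_n_m v 1 (S m)) in *.
  nra.
Qed.

(** Regroups by increments: w_k receives one term from its own step and one from the step before,
    which is the shape of [hatakern]. The last term belongs to w_n when S m = n - 1. *)
Lemma sum_n_m_moment (e r w : nat -> R) (m : nat) :
  (forall k, (2 <= k)%nat -> 0 < r k) ->
  sum_n_m (fun k => e k * (w (k + 1)%nat - r (k + 1)%nat * w k)
                    / (r (k + 1)%nat * (1 + r (k + 1)%nat))) 1 (S m)
  = sum_n_m (fun k => ((if (k =? 1)%nat then 0 else e (k - 1)%nat / (r k * (1 + r k)))
                       - e k / (1 + r (k + 1)%nat)) * w k) 1 (S m)
    + e (S m) / (r (S m + 1)%nat * (1 + r (S m + 1)%nat)) * w (S m + 1)%nat :> R.
Proof.
  intros Hr; induction m as [|m IH].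
  - rewrite !sum_n_n; simpl.
    assert (H := Hr 2%nat ltac:(lia)); field; lra.
  - rewrite sum_n_m_Rsucc, IH by lia.
    rewrite (sum_n_m_Rsucc _ 1 (S m)) by lia.
    assert (H := Hr (S (S m)) ltac:(lia)). assert (H' := Hr (S (S m) + 1)%nat ltac:(lia)).
    destruct (Nat.eqb_spec (S (S m)) 1); [lia|].
    replace (S (S m) - 1)%nat with (S m) by lia; replace (S m + 1)%nat with (S (S m)) by lia.
    field; lra.
Qed.

Lemma FBDF2_1 (al : R) (t : nat -> R) (v : nat -> R -> R -> R) (x y : R) :
  FBDF2 al t v 1 x y = akern al t 1 1 * dtau v 1 x y.
Proof. reflexivity. Qed.

(** The diagonal weight is split as [1 = (1-al)/(2-al) + 1/(2-al)]: the first share goes to the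
    convolution, the second is kept to control w_(n-1) and the nonlinearity. *)
Lemma FBDF2_hatakern (al : R) (t : nat -> R) (v : nat -> R -> R -> R) (n : nat) (x y : R) :
  0 < al < 1 -> (forall k, t k < t (S k)) -> (2 <= n)%nat ->
  FBDF2 al t v n x y
  = sum_n_m (fun k => hatakern al t n k * dtau v k x y) 1 n
    + (akern al t n n / (2 - al) + ratio t n * etakern al t n n / (1 + ratio t n)) * dtau v n x y
    - ratio t n ^ 2 * etakern al t n n / (1 + ratio t n) * dtau v (n - 1)%nat x y.
Proof.
  intros Hal Ht Hn.
  assert (Hr : forall k, (2 <= k)%nat -> 0 < ratio t k) by (intros; apply ratio_pos; assumption).
  destruct n as [|[|m]]; [lia | lia |].
  unfold FBDF2.
  replace (S (S m) - 1)%nat with (S m) by lia.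
  rewrite (sum_n_m_moment (etakern al t (S (S m))) (ratio t) (fun k => dtau v k x y)) by exact Hr.
  rewrite (sum_n_m_Rsucc (fun k => hatakern al t (S (S m)) k * dtau v k x y)) by lia.
  rewrite (sum_n_m_Rsucc (fun k => akern al t (S (S m)) k * dtau v k x y)) by lia.
  rewrite hatakern_diag by (assumption || lia).
  rewrite (sum_n_m_Rext (fun k => hatakern al t (S (S m)) k * dtau v k x y)
    (fun k => akern al t (S (S m)) k * dtau v k x y
       + (((if (k =? 1)%nat then 0 else etakern al t (S (S m)) (k - 1)%nat / (ratio t k * (1 + ratio t k)))
          - etakern al t (S (S m)) k / (1 + ratio t (k + 1)%nat)) * dtau v k x y))).
  - rewrite sum_n_m_Rplus; unfold etaprev.
    destruct (Nat.eqb_spec (S (S m)) 1); [lia|].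
    replace (S (S m) - 1)%nat with (S m) by lia; replace (S m + 1)%nat with (S (S m)) by lia.
    assert (H := Hr (S (S m)) ltac:(lia)).
    field; lra.
  - intros k Hk; rewrite hatakern_lt by (assumption || lia); unfold etaprev.
    destruct (k =? 1)%nat; ring.
Qed.

(** * The energy estimate *)

Definition mod_coef (al : R) (t : nat -> R) (n : nat) : R :=
  al * Rpower (ratio t (n + 1)%nat) (2 - al / 2)
    / (2 * (1 + ratio t (n + 1)%nat) * Rpower (tau t n) al * Gamma (3 - al)).

(* The part of FBDF2 not carried by the kernels [hatakern]: the scheme reads
   [sum_k hatakern n k * w_k + diag_rest n * w_n - subdiag_rest n * w_(n-1)]. *)
Definition diag_rest (al : R) (t : nat -> R) (n : nat) : R :=
  akern al t n n / (2 - al) + ratio t n * etakern al t n n / (1 + ratio t n).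

Definition subdiag_rest (al : R) (t : nat -> R) (n : nat) : R :=
  ratio t n ^ 2 * etakern al t n n / (1 + ratio t n).

Definition slack (al : R) (t : nat -> R) (n : nat) : R :=
  gfun (ratio t n) (ratio t (n + 1)) al / (2 * Rpower (tau t n) al * Gamma (3 - al)).

(* Young's inequality [2 r^2 a b <= r^(2 - al/2) a^2 + r^(2 + al/2) b^2]; the second
   exponent is tuned so that [r_n^al tau_n^(-al) = tau_(n-1)^(-al)]. *)
Lemma rest_ge_mod_coef (al : R) (t : nat -> R) (n : nat) (a b : R) :
  0 < al < 1 -> (forall k, t k < t (S k)) -> (2 <= n)%nat ->
  mod_coef al t n * a ^ 2 - mod_coef al t (n - 1) * b ^ 2 + slack al t n * a ^ 2
  <= diag_rest al t n * a ^ 2 - subdiag_rest al t n * a * b.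
Proof.
  intros Hal Ht Hn.
  assert (Hr : 0 < ratio t n) by (apply ratio_pos; assumption).
  assert (Hr' : 0 < ratio t (n + 1)) by (apply ratio_pos; [assumption | lia]).
  assert (Htau : 0 < tau t n) by (apply tau_pos; [assumption | lia]).
  assert (Htau' : 0 < tau t (n - 1)) by (apply tau_pos; [assumption | lia]).
  assert (HG : 0 < Gamma (1 - al)) by (apply Gamma_pos; lra).
  assert (HG3 : Gamma (3 - al) = (2 - al) * (1 - al) * Gamma (1 - al)).
  { replace (3 - al) with (1 - al + 2) by ring; rewrite Gamma_succ_succ by lra; ring. }
  unfold mod_coef, diag_rest, subdiag_rest, slack, gfun.
  replace (n - 1 + 1)%nat with n by lia.
  rewrite HG3, etakern_diag, akern_diag by (assumption || lia).
  rewrite Rpower_Ropp.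
  assert (Hrt : tau t n = ratio t n * tau t (n - 1))
    by (rewrite ratio_eq by exact Hn; field; lra).
  set (r := ratio t n) in *; set (r' := ratio t (n + 1)) in *; set (G := Gamma (1 - al)) in *.
  set (P := Rpower r (2 - al / 2)); set (P' := Rpower r' (2 - al / 2)).
  assert (HP : 0 < P) by apply Rpower_pos.
  set (u := Rpower (tau t (n - 1)) al).
  assert (Hu : 0 < u) by apply Rpower_pos.
  assert (Hru : Rpower (tau t n) al = Rpower r al * u)
    by (rewrite Hrt; symmetry; apply Rpower_mult_distr; assumption).
  assert (HPP : P * P = r ^ 4 / Rpower r al).
  { unfold P; rewrite <- Rpower_plus, <- (Rpower_pow 4 r Hr).
    unfold Rdiv; rewrite <- Rpower_Ropp, <- Rpower_plus; f_equal; simpl; lra. }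
  assert (Hra : 0 < Rpower r al) by apply Rpower_pos.
  set (w := Rpower (tau t n) al) in *.
  assert (Hw : 0 < w) by apply Rpower_pos.
  assert (Hkey : 0 <= P * a ^ 2 - 2 * r ^ 2 * a * b + P * (w / u) * b ^ 2).
  { apply Rmult_le_reg_l with P; [exact HP|].
    replace (P * (P * a ^ 2 - 2 * r ^ 2 * a * b + P * (w / u) * b ^ 2))
      with ((P * a - r ^ 2 * b) ^ 2 + (P * P * (w / u) - r ^ 4) * b ^ 2) by ring.
    rewrite HPP, Hru; replace (r ^ 4 / Rpower r al * (Rpower r al * u / u)) with (r ^ 4) by (field; lra).
    rewrite Rminus_diag, Rmult_0_l, Rmult_0_r, Rplus_0_r; apply pow2_ge_0. }
  apply Rminus_le_0.
  match goal with |- 0 <= ?e => replace e with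
    (al / (2 * (1 + r) * w * ((2 - al) * (1 - al) * G))
     * (P * a ^ 2 - 2 * r ^ 2 * a * b + P * (w / u) * b ^ 2)) end.
  - apply Rmult_le_pos; [|exact Hkey].
    apply Rdiv_le_0_compat; [lra|].
    repeat apply Rmult_lt_0_compat; lra.
  - field; repeat split; lra.
Qed.

(** The step condition is raised to the power al, which requires a positive base since [Rpower] is
    not the usual power otherwise. The constant 1/8 is the discriminant condition of the quadratic
    form in [EnergyAlpha_decay]. *)
Lemma slack_bound (al kappa eps : R) (t : nat -> R) (n : nat) :
  0 < al < 1 -> 0 < kappa -> 0 < eps -> 0 < tau t n ->
  0 < 4 * eps ^ 2 / kappa * (gfun (ratio t n) (ratio t (n + 1)%nat) al / Gamma (3 - al)) ->
  tau t n <= Rpower (4 * eps ^ 2 / kappa * (gfun (ratio t n) (ratio t (n + 1)%nat) al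
                                            / Gamma (3 - al))) (/ al) ->
  / 8 <= eps ^ 2 * (slack al t n / kappa).
Proof.
  intros Hal Hk He Htau H0 Hstep; unfold slack.
  set (g := gfun (ratio t n) (ratio t (n + 1)) al) in *.
  assert (HG : 0 < Gamma (3 - al)).
  { replace (3 - al) with (1 - al + 2) by ring; rewrite Gamma_succ_succ by lra.
    repeat apply Rmult_lt_0_compat; try lra; apply Gamma_pos; lra. }
  assert (Hle : Rpower (tau t n) al <= 4 * eps ^ 2 / kappa * (g / Gamma (3 - al))).
  { rewrite <- (Rpower_1 (4 * eps ^ 2 / kappa * (g / Gamma (3 - al)))) by exact H0.
    rewrite <- (Rinv_l al) by lra; rewrite <- Rpower_mult.
    apply Rle_Rpower_l; lra. }
  assert (Hw : 0 < Rpower (tau t n) al) by apply Rpower_pos.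
  apply Rmult_le_reg_l with (8 * Rpower (tau t n) al); [lra|].
  replace (8 * Rpower (tau t n) al * (eps ^ 2 * (g / (2 * Rpower (tau t n) al * Gamma (3 - al)) / kappa)))
    with (4 * eps ^ 2 / kappa * (g / Gamma (3 - al))) by (field; lra).
  lra.
Qed.

(** The convex part [p^4/4] lies above its tangents; the concave part [-p^2/2] contributes exactly
    the remainder [(a-b)^2/2]. *)
Lemma double_well_convex_split (a b : R) :
  Fdw a - Fdw b <= (a ^ 3 - a) * (a - b) + / 2 * (a - b) ^ 2.
Proof.
  unfold Fdw; apply Rminus_le_0.
  replace ((a ^ 3 - a) * (a - b) + / 2 * (a - b) ^ 2 - (/ 4 * (a ^ 2 - 1) ^ 2 - / 4 * (b ^ 2 - 1) ^ 2))
    with (/ 4 * ((a ^ 2 - b ^ 2) ^ 2 + 2 * (a * (a - b)) ^ 2)) by field.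
  assert (H1 := pow2_ge_0 (a ^ 2 - b ^ 2)). assert (H2 := pow2_ge_0 (a * (a - b))). lra.
Qed.

Ltac cont2_tac :=
  repeat match goal with
  | H : cont2 ?f |- cont2 ?f => exact H
  | H : forall k, cont2 (?f k) |- cont2 (?f _) => apply H
  | |- cont2 (fun _ _ => ?c) => apply cont2_const
  | |- cont2 (fun x y => @?f x y + @?g x y) => apply (cont2_plus f g)
  | |- cont2 (fun x y => @?f x y - @?g x y) => apply (cont2_minus f g)
  | |- cont2 (fun x y => @?f x y * @?g x y) => apply (cont2_mult f g)
  | |- cont2 (fun x y => - @?f x y) => apply (cont2_opp f)
  | |- cont2 (fun x y => @?f x y ^ ?n) => apply (cont2_pow f n)
  end.

Lemma iint_le (L1 L2 : R) (f g : R -> R -> R) : 0 < L1 -> 0 < L2 -> cont2 f -> cont2 g ->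
  (forall x y, f x y <= g x y) -> iint L1 L2 f <= iint L1 L2 g.
Proof.
  intros HL1 HL2 Hf Hg H; apply Rminus_le_0; rewrite <- iint_minus by assumption.
  apply iint_ge_0; try assumption; [cont2_tac|].
  intros x y; generalize (H x y); lra.
Qed.

Lemma cont2_conv_form (A : nat -> R) (v : nat -> R -> R -> R) (n : nat) : (1 <= n)%nat ->
  (forall k, (1 <= k <= n)%nat -> cont2 (v k)) ->
  cont2 (fun x y => conv_form A (fun k => v k x y) n).
Proof.
  intros Hn Hv; unfold conv_form.
  assert (Hs : forall j, cont2 (fun x y => sum_n_m (fun k => v k x y) (j + 1) n))
    by (intros j; apply cont2_sum; intros; apply Hv; lia).
  apply cont2_plus.
  - apply (cont2_sum (fun j x y => (A (j + 1)%nat - A j) * sum_n_m (fun k => v k x y) (j + 1) n ^ 2)).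
    intros j Hj; apply cont2_mult; [apply cont2_const | apply cont2_pow, Hs].
  - apply cont2_mult; [apply cont2_const | apply cont2_pow, (Hs 0%nat)].
Qed.

Lemma iint_conv_form (L1 L2 : R) (A : nat -> R) (v : nat -> R -> R -> R) (n : nat) : 0 < L2 ->
  (1 <= n)%nat -> (forall k, (1 <= k <= n)%nat -> cont2 (v k)) ->
  iint L1 L2 (fun x y => conv_form A (fun k => v k x y) n)
  = sum_n_m (fun j => (A (j + 1)%nat - A j)
        * iint L1 L2 (fun x y => sum_n_m (fun k => v k x y) (j + 1) n ^ 2)) 1 (n - 1)
    + A 1%nat * iint L1 L2 (fun x y => sum_n_m (fun k => v k x y) (0 + 1) n ^ 2).
Proof.
  intros HL2 Hn Hv; unfold conv_form.
  assert (Hs : forall j, cont2 (fun x y => sum_n_m (fun k => v k x y) (j + 1) n ^ 2))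
    by (intros j; apply cont2_pow, cont2_sum; intros; apply Hv; lia).
  rewrite (iint_plus L1 L2
    (fun x y => sum_n_m (fun j => (A (j + 1)%nat - A j) * sum_n_m (fun k => v k x y) (j + 1) n ^ 2) 1 (n - 1))
    (fun x y => A 1%nat * sum_n_m (fun k => v k x y) 1 n ^ 2)).
  - rewrite (iint_sum L1 L2
      (fun j x y => (A (j + 1)%nat - A j) * sum_n_m (fun k => v k x y) (j + 1) n ^ 2)).
    + f_equal.
      * apply sum_n_m_Rext; intros j Hj; apply (iint_scal L1 L2 _ _ HL2 (Hs j)).
      * apply (iint_scal L1 L2 _ _ HL2 (Hs 0%nat)).
    + exact HL2.
    + intros j Hj; apply cont2_mult; [apply cont2_const | apply Hs].
  - exact HL2.
  - apply (cont2_sum (fun j x y => (A (j + 1)%nat - A j) * sum_n_m (fun k => v k x y) (j + 1) n ^ 2)).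
    intros j Hj; apply cont2_mult; [apply cont2_const | apply Hs].
  - apply cont2_mult; [apply cont2_const | apply (Hs 0%nat)].
Qed.

Lemma Energy_iint (L1 L2 eps : R) (f : R -> R -> R) : 0 < L1 -> 0 < L2 -> smooth 1 f ->
  Energy L1 L2 eps f
  = iint L1 L2 (fun x y => eps ^ 2 / 2 * (dx f x y ^ 2 + dy f x y ^ 2) + Fdw (f x y)).
Proof.
  intros HL1 HL2 Hf.
  assert (Cf := smooth_cont2 _ _ Hf).
  assert (Cx := cont2_smooth_1_dx _ Hf). assert (Cy := cont2_smooth_1_dy _ Hf).
  unfold Energy, gradnorm.
  change (ip L1 L2 (dx f) (dx f)) with (iint L1 L2 (fun x y => dx f x y * dx f x y)).
  change (ip L1 L2 (dy f) (dy f)) with (iint L1 L2 (fun x y => dy f x y * dy f x y)).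
  change (ip L1 L2 (fun x y => Fdw (f x y)) (fun _ _ => 1))
    with (iint L1 L2 (fun x y => Fdw (f x y) * 1)).
  rewrite <- iint_plus by (try assumption; cont2_tac).
  rewrite pow2_sqrt.
  - rewrite <- iint_scal by (try assumption; cont2_tac).
    rewrite <- iint_plus; [apply iint_ext; intros; unfold Fdw; ring | exact HL2 | cont2_tac |].
    unfold Fdw; cont2_tac.
  - apply iint_ge_0; try assumption; [cont2_tac|].
    intros x y; nra.
Qed.

(** * Potentials of the increments and the energy in terms of their gradients *)

Section Scheme.

Context (al kappa eps L1 L2 : R) (t : nat -> R) (N : nat) (phi : nat -> R -> R -> R)
  (Hal : 0 < al < 1) (Hkappa : 0 < kappa) (Heps : 0 < eps)
  (HL1 : 0 < L1) (HL2 : 0 < L2) (Ht : forall k, t k < t (S k))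
  (Hreg : forall n, (n <= N)%nat -> periodic L1 L2 (phi n) /\ Ck 4 (phi n)).

Definition chem_pot (f : R -> R -> R) : R -> R -> R :=
  fun x y => f x y ^ 3 - f x y - eps ^ 2 * lap f x y.

Context
  (Hscheme : forall n, (1 <= n <= N)%nat -> forall x y,
      FBDF2 al t phi n x y = kappa * lap (chem_pot (phi n)) x y).

Lemma phi_smooth (n : nat) : (n <= N)%nat -> smooth 4 (phi n).
Proof. intros Hn; apply Ck_smooth, Hreg, Hn. Qed.

(** Only sums, products and scalings remain, so the closure lemmas for [smooth] and [periodic] apply
    directly. *)
Lemma chem_pot_eq (f : R -> R -> R) :
  chem_pot f = fun x y => f x y * (f x y * f x y) + ((-1) * f x y + (- eps ^ 2) * lap f x y).
Proof. extensionality x; extensionality y; unfold chem_pot; ring. Qed.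

Lemma chem_pot_smooth (n : nat) : (n <= N)%nat -> smooth 2 (chem_pot (phi n)).
Proof.
  intros Hn; rewrite chem_pot_eq; assert (Hs := phi_smooth n Hn).
  assert (Hs2 : smooth 2 (phi n)) by (apply (smooth_le 2 4); [lia | exact Hs]).
  apply smooth_plus; [apply smooth_mult; [|apply smooth_mult]; exact Hs2|].
  apply smooth_plus; apply smooth_scal; [exact Hs2 | apply smooth_lap, Hs].
Qed.

Lemma chem_pot_periodic (n : nat) : (n <= N)%nat -> periodic L1 L2 (chem_pot (phi n)).
Proof.
  intros Hn; rewrite chem_pot_eq; destruct (Hreg n Hn) as [Hp _].
  apply periodic_plus; [apply periodic_mult; [|apply periodic_mult]; exact Hp|].
  apply periodic_plus; apply periodic_scal; [exact Hp | apply periodic_lap, Hp].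
Qed.

Lemma FBDF2_potential (n : nat) : (1 <= n <= N)%nat ->
  potential L1 L2 (fun x y => (- kappa) * chem_pot (phi n) x y) (FBDF2 al t phi n).
Proof.
  intros Hn.
  apply potential_ext with (fun x y => (- kappa) * - lap (chem_pot (phi n)) x y).
  - intros x y; rewrite Hscheme by exact Hn; ring.
  - apply potential_scal; split; [apply chem_pot_periodic; lia | split; [apply chem_pot_smooth; lia|]].
    reflexivity.
Qed.

Let W (k : nat) : R -> R -> R := inv_neg_lap L1 L2 (dtau phi k).

(* Poisson's equation need not be solved: the scheme itself exhibits a nonzero multiple
   of [dtau phi n] plus earlier increments as a Laplacian. *)
Lemma W_potential (n : nat) : (1 <= n <= N)%nat -> potential L1 L2 (W n) (dtau phi n).
Proof.
  induction n as [n IH] using (well_founded_induction Nat.lt_wf_0); intros Hn.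
  cut (exists w, potential L1 L2 w (dtau phi n)).
  { intros [w Hw]; apply inv_neg_lap_potential with w; assumption. }
  assert (HF := FBDF2_potential n Hn).
  assert (Ha : 0 < akern al t n n) by (apply akern_diag_pos; [exact Hal | exact Ht | lia]).
  destruct (Nat.eq_dec n 1) as [->|Hne].
  - eexists; eapply potential_ext; [|apply (potential_scal _ _ (/ akern al t 1 1)), HF].
    intros x y; cbv beta; rewrite FBDF2_1; field; lra.
  - set (c := hatakern al t n n + diag_rest al t n).
    assert (Hr : 0 < ratio t n) by (apply ratio_pos; [exact Ht | lia]).
    assert (Hc : 0 < c).
    { unfold c, diag_rest; rewrite hatakern_diag, etakern_diag by (assumption || lia).
      unfold etaprev; destruct (Nat.eqb_spec n 1); [lia|].
      assert (0 <= etakern al t n (n - 1) / (ratio t n * (1 + ratio t n))).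
      { apply Rdiv_le_0_compat; [apply etakern_ge_0; (assumption || lia) | nra]. }
      assert (0 < (1 - al) / (2 - al) * akern al t n n)
        by (apply Rmult_lt_0_compat; [apply Rdiv_lt_0_compat; lra | exact Ha]).
      assert (0 < akern al t n n / (2 - al)) by (apply Rdiv_lt_0_compat; lra).
      assert (0 <= ratio t n * (al / (2 - al) * akern al t n n) / (1 + ratio t n)).
      { apply Rdiv_le_0_compat; [|lra].
        apply Rmult_le_pos; [lra|].
        apply Rmult_le_pos; [left; apply Rdiv_lt_0_compat; lra | lra]. }
      lra. }
    assert (HS : potential L1 L2
       (fun x y => sum_n_m (fun k => hatakern al t n k * W k x y) 1 (n - 1))
       (fun x y => sum_n_m (fun k => hatakern al t n k * dtau phi k x y) 1 (n - 1))).
    { apply (potential_sum _ _ (fun k x y => hatakern al t n k * W k x y)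
               (fun k x y => hatakern al t n k * dtau phi k x y)).
      intros k Hk; apply potential_scal, IH; lia. }
    assert (H1 : potential L1 L2 (W (n - 1)%nat) (dtau phi (n - 1))) by (apply IH; lia).
    assert (HP := potential_plus _ _ _ _ _ _ HF
      (potential_plus _ _ _ _ _ _ (potential_scal _ _ (-1) _ _ HS)
         (potential_scal _ _ (subdiag_rest al t n) _ _ H1))).
    eexists; eapply potential_ext; [|exact (potential_scal _ _ (/ c) _ _ HP)].
    intros x y; cbv beta.
    rewrite FBDF2_hatakern by (assumption || lia).
    fold (diag_rest al t n) (subdiag_rest al t n).
    replace (sum_n_m (fun k => hatakern al t n k * dtau phi k x y) 1 n)
      with (sum_n_m (fun k => hatakern al t n k * dtau phi k x y) 1 (n - 1)
            + hatakern al t n n * dtau phi n x y).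
    + unfold c in *; field; lra.
    + replace n with (S (n - 1)) at 5 by lia.
      rewrite sum_n_m_Rsucc by lia; replace (S (n - 1)) with n by lia; reflexivity.
Qed.

Let X (k : nat) : R -> R -> R := dx (W k).
Let Y (k : nat) : R -> R -> R := dy (W k).

Lemma W_smooth_1 (k : nat) : (1 <= k <= N)%nat -> smooth 1 (W k).
Proof. intros Hk; apply smooth_pred; apply W_potential, Hk. Qed.

Lemma X_cont2 (k : nat) : (1 <= k <= N)%nat -> cont2 (X k).
Proof. intros Hk; apply cont2_smooth_1_dx, W_smooth_1, Hk. Qed.

Lemma Y_cont2 (k : nat) : (1 <= k <= N)%nat -> cont2 (Y k).
Proof. intros Hk; apply cont2_smooth_1_dy, W_smooth_1, Hk. Qed.

Lemma norm_m1_dtau (n : nat) : (1 <= n <= N)%nat ->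
  norm_m1 L1 L2 (dtau phi n) ^ 2 = iint L1 L2 (fun x y => X n x y ^ 2 + Y n x y ^ 2).
Proof. intros Hn; apply norm_m1_sqr; [assumption.. | apply W_potential, Hn]. Qed.

Lemma norm_m1_dsum (j n : nat) : (1 <= n <= N)%nat ->
  norm_m1 L1 L2 (dsum phi j n) ^ 2
  = iint L1 L2 (fun x y => sum_n_m (fun k => X k x y) (j + 1) n ^ 2)
    + iint L1 L2 (fun x y => sum_n_m (fun k => Y k x y) (j + 1) n ^ 2).
Proof.
  intros Hn.
  rewrite (norm_m1_sqr L1 L2 (fun x y => sum_n_m (fun k => W k x y) (j + 1) n)).
  - rewrite <- iint_plus.
    + apply iint_ext; intros x y.
      rewrite dx_sum, dy_sum; [reflexivity | intros; apply W_smooth_1; lia..].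
    + exact HL2.
    + apply cont2_pow, cont2_sum; intros; apply X_cont2; lia.
    + apply cont2_pow, cont2_sum; intros; apply Y_cont2; lia.
  - exact HL1.
  - exact HL2.
  - apply (potential_sum _ _ W (dtau phi)); intros k Hk; apply W_potential; lia.
Qed.

(** The nonlocal part of the energy, times kappa, as a density: with [V_k = grad W_k], every
    negative norm becomes the integral of a squared sum of the V_k. *)
Definition mod_density (n : nat) (x y : R) : R :=
  mod_coef al t n * (X n x y ^ 2 + Y n x y ^ 2)
  + / 2 * (conv_form (Akern al t n) (fun k => X k x y) n
           + conv_form (Akern al t n) (fun k => Y k x y) n).

Lemma mod_density_cont2 (n : nat) : (1 <= n <= N)%nat -> cont2 (mod_density n).
Proof.
  intros Hn; unfold mod_density.
  assert (HX := X_cont2 n Hn). assert (HY := Y_cont2 n Hn).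
  assert (HcX := cont2_conv_form (Akern al t n) X n ltac:(lia) ltac:(intros; apply X_cont2; lia)).
  assert (HcY := cont2_conv_form (Akern al t n) Y n ltac:(lia) ltac:(intros; apply Y_cont2; lia)).
  apply cont2_plus; apply cont2_mult; try apply cont2_const.
  - apply cont2_plus; apply cont2_pow; assumption.
  - apply cont2_plus; assumption.
Qed.

Lemma EnergyAlpha_eq (n : nat) : (1 <= n <= N)%nat ->
  EnergyAlpha L1 L2 eps kappa al t phi n
  = Energy L1 L2 eps (phi n) + / kappa * iint L1 L2 (mod_density n).
Proof.
  intros Hn; unfold EnergyAlpha; do 2 f_equal.
  assert (HX := X_cont2 n Hn). assert (HY := Y_cont2 n Hn).
  assert (HcX := cont2_conv_form (Akern al t n) X n ltac:(lia) ltac:(intros; apply X_cont2; lia)).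
  assert (HcY := cont2_conv_form (Akern al t n) Y n ltac:(lia) ltac:(intros; apply Y_cont2; lia)).
  unfold mod_density.
  rewrite (iint_plus L1 L2 (fun x y => mod_coef al t n * (X n x y ^ 2 + Y n x y ^ 2))
    (fun x y => / 2 * (conv_form (Akern al t n) (fun k => X k x y) n
           + conv_form (Akern al t n) (fun k => Y k x y) n))).
  - rewrite (iint_scal L1 L2 (mod_coef al t n) (fun x y => X n x y ^ 2 + Y n x y ^ 2));
      [| exact HL2 | apply cont2_plus; apply cont2_pow; assumption].
    rewrite (iint_scal L1 L2 (/ 2) (fun x y => conv_form (Akern al t n) (fun k => X k x y) n
           + conv_form (Akern al t n) (fun k => Y k x y) n));
      [| exact HL2 | apply cont2_plus; assumption].
    rewrite (iint_plus L1 L2 (fun x y => conv_form (Akern al t n) (fun k => X k x y) n)) by assumption.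
    rewrite (iint_conv_form L1 L2 (Akern al t n) X n HL2 ltac:(lia) ltac:(intros; apply X_cont2; lia)).
    rewrite (iint_conv_form L1 L2 (Akern al t n) Y n HL2 ltac:(lia) ltac:(intros; apply Y_cont2; lia)).
    rewrite norm_m1_dtau, (norm_m1_dsum 0) by exact Hn.
    rewrite (sum_n_m_Rext _ (fun j =>
        (Akern al t n (j + 1) - Akern al t n j)
          * iint L1 L2 (fun x y => sum_n_m (fun k => X k x y) (j + 1) n ^ 2)
        + (Akern al t n (j + 1) - Akern al t n j)
          * iint L1 L2 (fun x y => sum_n_m (fun k => Y k x y) (j + 1) n ^ 2)))
      by (intros j Hj; rewrite norm_m1_dsum by exact Hn; ring).
    rewrite sum_n_m_Rplus; unfold mod_coef; ring.
  - exact HL2.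
  - apply cont2_mult; [apply cont2_const | apply cont2_plus; apply cont2_pow; assumption].
  - apply cont2_mult; [apply cont2_const | apply cont2_plus; assumption].
Qed.

(** * Increments of the two parts of the energy *)

Context (Hr : forall k, (2 <= k)%nat -> Rstar <= ratio t k).

(** Passing from [hatakern] to [Akern] adds [hatakern n n * v_n^2] to the form. This equals the term
    [A_n v_n^2 / 2] gained in [conv_form_decay], so the two cancel. *)
Lemma mod_density_decay (n : nat) (v : nat -> R) : (2 <= n)%nat ->
  mod_coef al t n * v n ^ 2 + / 2 * conv_form (Akern al t n) v n
  - (mod_coef al t (n - 1) * v (n - 1)%nat ^ 2 + / 2 * conv_form (Akern al t (n - 1)) v (n - 1))
  + slack al t n * v n ^ 2
  <= v n * (sum_n_m (fun k => hatakern al t n k * v k) 1 n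
            + (diag_rest al t n * v n - subdiag_rest al t n * v (n - 1)%nat)).
Proof.
  intros Hn.
  assert (H1 := conv_form_decay (Akern al t n) (Akern al t (n - 1)) v n Hn
     (Akern_first_decay al Hal t Ht n Hn)
     (fun j Hj => Akern_increment_decay al Hal t Ht Hr n j Hj)).
  assert (H2 := rest_ge_mod_coef al t n (v n) (v (n - 1)%nat) Hal Ht Hn).
  assert (E : sum_n_m (fun k => Akern al t n k * v k) 1 n
     = sum_n_m (fun k => hatakern al t n k * v k) 1 n + hatakern al t n n * v n :> R).
  { destruct n as [|m]; [lia|].
    rewrite !sum_n_m_Rsucc, Akern_diag by lia.
    rewrite (sum_n_m_Rext (fun k => Akern al t (S m) k * v k)
               (fun k => hatakern al t (S m) k * v k));
      [ring | intros k Hk; rewrite Akern_lt by lia; reflexivity]. }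
  rewrite E, Akern_diag in H1.
  nra.
Qed.

(** The combination U of the W_k is a potential of the discrete derivative. Green's formula turns
    grad W_n . grad U into kappa W_n lap mu, and two further uses move the Laplacian onto W_n. *)
Lemma iint_scheme (n : nat) : (2 <= n <= N)%nat ->
  iint L1 L2 (fun x y =>
     X n x y * (sum_n_m (fun k => hatakern al t n k * X k x y) 1 n
                + (diag_rest al t n * X n x y - subdiag_rest al t n * X (n - 1)%nat x y))
     + Y n x y * (sum_n_m (fun k => hatakern al t n k * Y k x y) 1 n
                + (diag_rest al t n * Y n x y - subdiag_rest al t n * Y (n - 1)%nat x y)))
  = - kappa * iint L1 L2 (fun x y => chem_pot (phi n) x y * dtau phi n x y).
Proof.
  intros Hn.
  destruct (W_potential n ltac:(lia)) as [Pn [Sn En]].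
  assert (HS : potential L1 L2
     (fun x y => sum_n_m (fun k => hatakern al t n k * W k x y) 1 n)
     (fun x y => sum_n_m (fun k => hatakern al t n k * dtau phi k x y) 1 n)).
  { apply (potential_sum _ _ (fun k x y => hatakern al t n k * W k x y)
             (fun k x y => hatakern al t n k * dtau phi k x y)).
    intros k Hk; apply potential_scal, W_potential; lia. }
  assert (HR : potential L1 L2
     (fun x y => diag_rest al t n * W n x y + (- subdiag_rest al t n) * W (n - 1)%nat x y)
     (fun x y => diag_rest al t n * dtau phi n x y
                 + (- subdiag_rest al t n) * dtau phi (n - 1)%nat x y)).
  { apply (potential_plus _ _ (fun x y => diag_rest al t n * W n x y)
             (fun x y => (- subdiag_rest al t n) * W (n - 1)%nat x y));
      apply potential_scal, W_potential; lia. }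
  set (U := fun x y => sum_n_m (fun k => hatakern al t n k * W k x y) 1 n
     + (diag_rest al t n * W n x y + (- subdiag_rest al t n) * W (n - 1)%nat x y)).
  assert (HU : potential L1 L2 U (FBDF2 al t phi n)).
  { eapply potential_ext; [|exact (potential_plus _ _ _ _ _ _ HS HR)].
    intros x y; cbv beta; rewrite FBDF2_hatakern by (assumption || lia).
    unfold diag_rest, subdiag_rest; ring. }
  assert (Hsm : forall k, (1 <= k <= n)%nat -> smooth 1 (fun x y => hatakern al t n k * W k x y))
    by (intros; apply smooth_scal, W_smooth_1; lia).
  assert (SS : smooth 1 (fun x y => sum_n_m (fun k => hatakern al t n k * W k x y) 1 n))
    by (apply smooth_pred, HS).
  assert (SR : smooth 1 (fun x y => diag_rest al t n * W n x y + (- subdiag_rest al t n) * W (n - 1)%nat x y))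
    by (apply smooth_pred, HR).
  assert (S1 : smooth 1 (fun x y => diag_rest al t n * W n x y)) by (apply smooth_scal, W_smooth_1; lia).
  assert (S2 : smooth 1 (fun x y => (- subdiag_rest al t n) * W (n - 1)%nat x y))
    by (apply smooth_scal, W_smooth_1; lia).
  assert (EX : forall x y, dx U x y = sum_n_m (fun k => hatakern al t n k * X k x y) 1 n
                + (diag_rest al t n * X n x y - subdiag_rest al t n * X (n - 1)%nat x y)).
  { intros x y; unfold U.
    rewrite (dx_plus 0 _ _ SS SR), (dx_plus 0 _ _ S1 S2), !dx_scal.
    rewrite (dx_sum (fun k x y => hatakern al t n k * W k x y)) by exact Hsm.
    rewrite (sum_n_m_Rext _ (fun k => hatakern al t n k * X k x y))
      by (intros; rewrite dx_scal; reflexivity).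
    unfold X; ring. }
  assert (EY : forall x y, dy U x y = sum_n_m (fun k => hatakern al t n k * Y k x y) 1 n
                + (diag_rest al t n * Y n x y - subdiag_rest al t n * Y (n - 1)%nat x y)).
  { intros x y; unfold U.
    rewrite (dy_plus 0 _ _ SS SR), (dy_plus 0 _ _ S1 S2), !dy_scal.
    rewrite (dy_sum (fun k x y => hatakern al t n k * W k x y)) by exact Hsm.
    rewrite (sum_n_m_Rext _ (fun k => hatakern al t n k * Y k x y))
      by (intros; rewrite dy_scal; reflexivity).
    unfold Y; ring. }
  destruct HU as [PU [SU EU]].
  assert (Sm := chem_pot_smooth n ltac:(lia)). assert (Pm := chem_pot_periodic n ltac:(lia)).
  rewrite (iint_ext _ _ _ (fun x y => dx (W n) x y * dx U x y + dy (W n) x y * dy U x y))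
    by (intros; rewrite EX, EY; reflexivity).
  rewrite <- iint_green by (assumption || apply smooth_pred; assumption).
  rewrite (iint_ext _ _ _ (fun x y => - kappa * (W n x y * - lap (chem_pot (phi n)) x y)))
    by (intros; rewrite EU, Hscheme by lia; ring).
  rewrite iint_scal; [|exact HL2 |].
  - f_equal.
    rewrite iint_green by (assumption || apply smooth_pred; assumption).
    rewrite (iint_ext _ _ _ (fun x y => dx (chem_pot (phi n)) x y * dx (W n) x y
                 + dy (chem_pot (phi n)) x y * dy (W n) x y)) by (intros; ring).
    rewrite <- iint_green by (assumption || apply smooth_pred; assumption).
    apply iint_ext; intros; rewrite En; reflexivity.
  - apply cont2_mult; [apply (smooth_cont2 2); exact Sn|].
    apply cont2_opp, (smooth_cont2 0), smooth_lap, Sm.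
Qed.

Lemma dx_dtau (n : nat) (x y : R) : (1 <= n <= N)%nat ->
  dx (dtau phi n) x y = dx (phi n) x y - dx (phi (n - 1)%nat) x y.
Proof.
  intros Hn; apply Derive_minus; apply (smooth_ex_dx 3), phi_smooth; lia.
Qed.

Lemma dy_dtau (n : nat) (x y : R) : (1 <= n <= N)%nat ->
  dy (dtau phi n) x y = dy (phi n) x y - dy (phi (n - 1)%nat) x y.
Proof.
  intros Hn; apply Derive_minus; apply (smooth_ex_dy 3), phi_smooth; lia.
Qed.

Lemma dtau_smooth (n : nat) : (1 <= n <= N)%nat -> smooth 4 (dtau phi n).
Proof.
  intros Hn.
  replace (dtau phi n) with (fun x y => phi n x y + (-1) * phi (n - 1)%nat x y).
  - apply smooth_plus; [|apply smooth_scal]; apply phi_smooth; lia.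
  - extensionality x; extensionality y; unfold dtau; ring.
Qed.

Lemma dtau_periodic (n : nat) : (1 <= n <= N)%nat -> periodic L1 L2 (dtau phi n).
Proof.
  intros Hn.
  replace (dtau phi n) with (fun x y => phi n x y + (-1) * phi (n - 1)%nat x y).
  - apply periodic_plus; [|apply periodic_scal]; apply Hreg; lia.
  - extensionality x; extensionality y; unfold dtau; ring.
Qed.

(** The error [w_n^2 / 2] of the double well is kept as grad w_n . V_n, by Green's formula, so that
    it can be absorbed pointwise. *)
Lemma Energy_increment (n : nat) : (2 <= n <= N)%nat ->
  Energy L1 L2 eps (phi n) - Energy L1 L2 eps (phi (n - 1)%nat)
  <= iint L1 L2 (fun x y => chem_pot (phi n) x y * dtau phi n x y)
     + / 2 * iint L1 L2 (fun x y => dx (dtau phi n) x y * X n x y + dy (dtau phi n) x y * Y n x y)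
     - eps ^ 2 / 2 * iint L1 L2 (fun x y => dx (dtau phi n) x y ^ 2 + dy (dtau phi n) x y ^ 2).
Proof.
  intros Hn.
  assert (Sw := dtau_smooth n ltac:(lia)). assert (Pw := dtau_periodic n ltac:(lia)).
  assert (S1 := phi_smooth n ltac:(lia)). assert (S0 := phi_smooth (n - 1) ltac:(lia)).
  destruct (Hreg n ltac:(lia)) as [P1 _].
  destruct (W_potential n ltac:(lia)) as [PW [SW EW]].
  assert (Sw1 : smooth 1 (dtau phi n)) by (apply (smooth_le 1 4); [lia | exact Sw]).
  assert (S11 : smooth 1 (phi n)) by (apply (smooth_le 1 4); [lia | exact S1]).
  assert (S12 : smooth 2 (phi n)) by (apply (smooth_le 2 4); [lia | exact S1]).
  assert (S01 : smooth 1 (phi (n - 1)%nat)) by (apply (smooth_le 1 4); [lia | exact S0]).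
  assert (Cw := smooth_cont2 _ _ Sw). assert (C1 := smooth_cont2 _ _ S1).
  assert (C0 := smooth_cont2 _ _ S0).
  assert (Cxw := cont2_smooth_1_dx _ Sw1). assert (Cyw := cont2_smooth_1_dy _ Sw1).
  assert (Cx1 := cont2_smooth_1_dx _ S11). assert (Cy1 := cont2_smooth_1_dy _ S11).
  assert (Cx0 := cont2_smooth_1_dx _ S01). assert (Cy0 := cont2_smooth_1_dy _ S01).
  assert (Cl : cont2 (lap (phi n))) by (apply (smooth_cont2 2), smooth_lap, S1).
  set (f1 := fun x y => (phi n x y ^ 3 - phi n x y) * dtau phi n x y).
  set (f2 := fun x y => dtau phi n x y * dtau phi n x y).
  set (f3 := fun x y => dx (dtau phi n) x y * dx (phi n) x y + dy (dtau phi n) x y * dy (phi n) x y).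
  set (f4 := fun x y => dx (dtau phi n) x y ^ 2 + dy (dtau phi n) x y ^ 2).
  assert (Cf1 : cont2 f1) by (unfold f1; cont2_tac).
  assert (Cf2 : cont2 f2) by (unfold f2; cont2_tac).
  assert (Cf3 : cont2 f3) by (unfold f3; cont2_tac).
  assert (Cf4 : cont2 f4) by (unfold f4; cont2_tac).
  assert (E2 : iint L1 L2 (fun x y => dx (dtau phi n) x y * X n x y + dy (dtau phi n) x y * Y n x y)
               = iint L1 L2 f2).
  { unfold X, Y; rewrite <- iint_green by assumption.
    apply iint_ext; intros; unfold f2; rewrite EW; reflexivity. }
  assert (E1 : iint L1 L2 (fun x y => chem_pot (phi n) x y * dtau phi n x y)
               = iint L1 L2 f1 + eps ^ 2 * iint L1 L2 f3).
  { unfold f3; rewrite <- iint_green, <- iint_scal, <- iint_plus by (assumption || cont2_tac).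
    apply iint_ext; intros; unfold f1, chem_pot; ring. }
  rewrite E1, E2, !Energy_iint by assumption.
  rewrite <- iint_minus by (exact HL2 || (unfold Fdw; cont2_tac)).
  apply Rle_trans with (iint L1 L2 (fun x y =>
    f1 x y + (eps ^ 2 * f3 x y + (/ 2 * f2 x y + (- (eps ^ 2 / 2)) * f4 x y)))).
  - apply iint_le; [exact HL1 | exact HL2 | unfold Fdw; cont2_tac | cont2_tac |].
    (* For gradients p and q at levels n and n-1, [(|p|^2 - |q|^2)/2 = (p-q).p - |p-q|^2/2]. *)
    intros x y; unfold f1, f2, f3, f4.
    rewrite dx_dtau, dy_dtau by lia.
    assert (H := double_well_convex_split (phi n x y) (phi (n - 1)%nat x y)).
    unfold dtau; nra.
  - rewrite (iint_plus L1 L2 f1), (iint_plus L1 L2 (fun x y => eps ^ 2 * f3 x y)),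
      (iint_plus L1 L2 (fun x y => / 2 * f2 x y)), !iint_scal by (exact HL2 || cont2_tac).
    apply Req_le; ring.
Qed.

Lemma mod_density_increment (n : nat) : (2 <= n <= N)%nat ->
  iint L1 L2 (mod_density n) - iint L1 L2 (mod_density (n - 1))
    + slack al t n * iint L1 L2 (fun x y => X n x y ^ 2 + Y n x y ^ 2)
  <= - kappa * iint L1 L2 (fun x y => chem_pot (phi n) x y * dtau phi n x y).
Proof.
  intros Hn; rewrite <- iint_scheme by exact Hn.
  assert (HX := X_cont2 n ltac:(lia)). assert (HY := Y_cont2 n ltac:(lia)).
  assert (HX' := X_cont2 (n - 1) ltac:(lia)). assert (HY' := Y_cont2 (n - 1) ltac:(lia)).
  assert (HM := mod_density_cont2 n ltac:(lia)). assert (HM' := mod_density_cont2 (n - 1) ltac:(lia)).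
  rewrite <- iint_scal by (exact HL2 || cont2_tac).
  rewrite <- iint_minus, <- iint_plus by (exact HL2 || cont2_tac).
  assert (HSX : cont2 (fun x y => sum_n_m (fun k => hatakern al t n k * X k x y) 1 n)).
  { apply (cont2_sum (fun k x y => hatakern al t n k * X k x y)).
    intros k Hk; apply cont2_mult; [apply cont2_const | apply X_cont2; lia]. }
  assert (HSY : cont2 (fun x y => sum_n_m (fun k => hatakern al t n k * Y k x y) 1 n)).
  { apply (cont2_sum (fun k x y => hatakern al t n k * Y k x y)).
    intros k Hk; apply cont2_mult; [apply cont2_const | apply Y_cont2; lia]. }
  apply iint_le; [exact HL1 | exact HL2 | cont2_tac | cont2_tac |].
  intros x y.
  assert (DX := mod_density_decay n (fun k => X k x y) ltac:(lia)).
  assert (DY := mod_density_decay n (fun k => Y k x y) ltac:(lia)).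
  cbv beta in DX, DY; unfold mod_density; lra.
Qed.

(** After division by kappa the chemical potential terms of the two increments cancel, leaving a
    quadratic form in grad w_n and V_n. *)
Lemma EnergyAlpha_decay (n : nat) : (2 <= n <= N)%nat ->
  / 8 <= eps ^ 2 * (slack al t n / kappa) ->
  EnergyAlpha L1 L2 eps kappa al t phi n - EnergyAlpha L1 L2 eps kappa al t phi (n - 1)%nat <= 0.
Proof.
  intros Hn Hsl; rewrite !EnergyAlpha_eq by lia.
  assert (HE := Energy_increment n Hn). assert (HM := mod_density_increment n Hn).
  assert (HX := X_cont2 n ltac:(lia)). assert (HY := Y_cont2 n ltac:(lia)).
  assert (Sw1 : smooth 1 (dtau phi n)) by (apply (smooth_le 1 4); [lia | apply dtau_smooth; lia]).
  assert (Cxw := cont2_smooth_1_dx _ Sw1). assert (Cyw := cont2_smooth_1_dy _ Sw1).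
  set (s := slack al t n / kappa) in *.
  assert (He2 : 0 < eps ^ 2) by (apply pow_lt; exact Heps).
  (* Nonnegativity means [(1/2)^2 <= 4 (eps^2/2) s], that is [eps^2 s >= 1/8]; multiplying by
     [eps^2] completes the square without dividing. *)
  assert (Hquad : forall a b, 0 <= eps ^ 2 / 2 * a ^ 2 + s * b ^ 2 - / 2 * (a * b)).
  { intros a b; apply Rmult_le_reg_l with (eps ^ 2); [exact He2|].
    replace (eps ^ 2 * (eps ^ 2 / 2 * a ^ 2 + s * b ^ 2 - / 2 * (a * b)))
      with (/ 2 * (eps ^ 2 * a - / 2 * b) ^ 2 + (eps ^ 2 * s - / 8) * b ^ 2) by field.
    rewrite Rmult_0_r; apply Rplus_le_le_0_compat; apply Rmult_le_pos;
      try apply pow2_ge_0; lra. }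
  assert (HI : 0 <= iint L1 L2 (fun x y =>
     eps ^ 2 / 2 * (dx (dtau phi n) x y ^ 2 + dy (dtau phi n) x y ^ 2)
     + s * (X n x y ^ 2 + Y n x y ^ 2)
     - / 2 * (dx (dtau phi n) x y * X n x y + dy (dtau phi n) x y * Y n x y))).
  { apply iint_ge_0; [exact HL1 | exact HL2 | cont2_tac |].
    intros x y; generalize (Hquad (dx (dtau phi n) x y) (X n x y)),
      (Hquad (dy (dtau phi n) x y) (Y n x y)); lra. }
  rewrite iint_minus, iint_plus, !iint_scal in HI by (exact HL2 || cont2_tac).
  apply (Rmult_le_compat_l (/ kappa)) in HM; [|left; apply Rinv_0_lt_compat, Hkappa].
  rewrite !Ropp_mult_distr_l_reverse, Ropp_mult_distr_r_reverse, <- (Rmult_assoc (/ kappa) kappa),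
    Rinv_l, Rmult_1_l in HM by lra.
  unfold s, Rdiv in *; lra.
Qed.

End Scheme.

Theorem theorem3p2
  (al kappa eps L1 L2 : R) (t : nat -> R) (N : nat) (phi : nat -> R -> R -> R)
  (Hal : 0 < al < 1) (Hkappa : 0 < kappa) (Heps : 0 < eps)
  (HL1 : 0 < L1) (HL2 : 0 < L2)
  (Ht0 : t 0%nat = 0) (Ht : forall k, t k < t (S k))
  (Hreg : forall n, (n <= N)%nat -> periodic L1 L2 (phi n) /\ Ck 4 (phi n))
  (Hscheme : forall n, (1 <= n <= N)%nat -> forall x y,
      FBDF2 al t phi n x y =
      kappa * lap (fun x' y' => phi n x' y' ^ 3 - phi n x' y' - eps ^ 2 * lap (phi n) x' y') x y)
  (Hratio : forall k, (2 <= k)%nat -> Rstar <= ratio t k < rstar al)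
  (Hstep : forall n, (2 <= n)%nat ->
      0 < 4 * eps ^ 2 / kappa * (gfun (ratio t n) (ratio t (n + 1)%nat) al / Gamma (3 - al)) /\
      tau t n <= Rpower (4 * eps ^ 2 / kappa * (gfun (ratio t n) (ratio t (n + 1)%nat) al
                                                / Gamma (3 - al))) (/ al)) :
  forall n, (2 <= n <= N)%nat ->
    EnergyAlpha L1 L2 eps kappa al t phi n - EnergyAlpha L1 L2 eps kappa al t phi (n - 1)%nat <= 0.
Proof.
  intros n Hn.
  apply (EnergyAlpha_decay al kappa eps L1 L2 t N phi Hal Hkappa Heps HL1 HL2 Ht Hreg Hscheme
           (fun k Hk => proj1 (Hratio k Hk)) n Hn).
  destruct (Hstep n (proj1 Hn)) as [H0 H1].
  apply slack_bound; try assumption.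
  apply tau_pos; [exact Ht | lia].
Qed.
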